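(* Let $d\ge1$ be an integer and $\alpha>-1/2$. Then there exists a constant $\vartheta=\vartheta(d,\alpha)>0$ such that, for every $\Omega,S>0$ with $\Omega S^{1/d}\le\vartheta$ and for every $\varphi\in L^1(\mathbb{R}^d)$ with support of finite measure at most $S$, $$\left|\int_{\mathbb{R}^d}\Omega^{-d}m_\alpha(\xi/\Omega)\widehat{\varphi}(\xi)\,d\xi\right|\le\int_{\mathbb{R}^d}\Omega^{-d}m_\alpha(\xi/\Omega)\widehat{|\varphi|^*}(\xi)\,d\xi.$$
   Context: $\langle\cdot,\cdot\rangle$ and $|\cdot|$ are the standard scalar product and Euclidean norm on $\mathbb{R}^d$; $B(a,r)$ is the open ball of center $a$ and radius $r$; $|E|$ also denotes the Lebesgue measure of a Borel set $E$. The function $m_\alpha$ on $\mathbb{R}^d$ is $m_\alpha(x)=(1-|x|^2)_+^\alpha$, i.e. $(1-|x|^2)^\alpha$ if $|x|<1$ and $0$ otherwise. Fourier transform: $\widehat{\varphi}(\xi)=\int_{\mathbb{R}^d}\varphi(t)e^{-2i\pi\langle t,\xi\rangle}\,dt$ for $\varphi\in L^1(\mathbb{R}^d)$. Symmetric rearrangement: for a Borel set $E\subset\mathbb{R}^d$ of finite measure, $E^*=B(0,r)$ with $|B(0,r)|=|E|$. For a measurable function $\varphi$ whose level sets $\{|\varphi|>\lambda\}$ have finite measure for all $\lambda>0$, $|\varphi|^*(x)=\int_0^{+\infty}\chi_{\{y\in\mathbb{R}^d:\,|\varphi(y)|>\lambda\}^*}(x)\,d\lambda$, where $\chi_A$ is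 the characteristic function of $A$. *)

(* Defs.v *)
From HB Require Import structures.
From mathcomp Require Import all_boot all_order all_algebra.
From mathcomp Require Import all_classical all_reals all_analysis.
From mathcomp Require Import complex.

Set Implicit Arguments.
Unset Strict Implicit.
Unset Printing Implicit Defensive.

Import Order.TTheory GRing.Theory Num.Theory.
Import numFieldNormedType.Exports.

Local Open Scope classical_set_scope.
Local Open Scope ring_scope.
Local Open Scope complex_scope.

(* R^d is [d.-tuple R]; its library measurable structure, generated by the
   coordinate projections, is the Borel sigma-algebra. The library has no
   Lebesgue measure there, so it is built as an iterated product measure. *)
Section lebesgue_cons.
Context (R : realType) (n : nat).
Variable m : {sigma_finite_measure set (n.-tuple R) -> \bar R}.

Let prepend (p : measurableTypeR R * n.-tuple R) : n.+1.-tuple R :=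
  [tuple of (p.1 : R) :: p.2].

Let measurable_prepend :
  measurable_fun [set: measurableTypeR R * n.-tuple R] prepend.
Proof. exact: measurable_cons. Qed.

HB.instance Definition _ :=
  isMeasurableFun.Build _ _ _ _ prepend measurable_prepend.

Definition lebesgue_cons : set (n.+1.-tuple R) -> \bar R :=
  pushforward (@lebesgue_measure R \x m)%E prepend.

Let lebesgue_cons0 : lebesgue_cons set0 = 0%E.
Proof. exact: measure0. Qed.

Let lebesgue_cons_ge0 A : (0 <= lebesgue_cons A)%E.
Proof. exact: measure_ge0. Qed.

Let lebesgue_cons_sigma_additive : semi_sigma_additive lebesgue_cons.
Proof. exact: measure_semi_sigma_additive. Qed.

HB.instance Definition _ := isMeasure.Build _ _ _ lebesgue_cons
  lebesgue_cons0 lebesgue_cons_ge0 lebesgue_cons_sigma_additive.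

Let lebesgue_cons_sigma_finite :
  sigma_finite [set: n.+1.-tuple R] lebesgue_cons.
Proof.
have /sigma_finiteP[F [FT ndF Foo]] := sigma_finiteT (@lebesgue_measure R).
have /sigma_finiteP[G [GT ndG Goo]] := sigma_finiteT m.
pose split_head (t : n.+1.-tuple R) : measurableTypeR R * n.-tuple R :=
  (thead t, [tuple of behead t]).
have prependK : split_head \o prepend = id.
  by apply/funext => -[x t]; congr pair; apply: val_inj.
have msplit_head : measurable_fun [set: n.+1.-tuple R] split_head.
  apply/measurable_fun_pairP; split; first exact: measurable_tnth.
  exact: measurable_behead.
exists (fun k => split_head @^-1` (F k `*` G k)).
  apply/seteqP; split => // t _.
  have [k _ Fk] : (\bigcup_k F k) (thead t) by rewrite -FT.
  have [l _ Gl] : (\bigcup_k G k) [tuple of behead t] by rewrite -GT.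
  exists (maxn k l) => //; split.
  - by move: Fk; exact/subsetPset/ndF/leq_maxl.
  - by move: Gl; exact/subsetPset/ndG/leq_maxr.
move=> k; have [mF Fk] := Foo k; have [mG Gk] := Goo k.
have mFG := measurableX mF mG.
split; first by rewrite -[X in measurable X]setTI; exact: msplit_head.
rewrite /lebesgue_cons /pushforward -comp_preimage prependK preimage_id.
by rewrite product_measure1E// lte_mul_pinfty// ge0_fin_numE.
Qed.

HB.instance Definition _ := Measure_isSigmaFinite.Build _ _ _ lebesgue_cons
  lebesgue_cons_sigma_finite.

End lebesgue_cons.

Fixpoint lebesgue_tuple (R : realType) (n : nat) :
    {sigma_finite_measure set (n.-tuple R) -> \bar R} :=
  if n is k.+1 then lebesgue_cons (lebesgue_tuple R k)
  else \d_ [tuple].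

Section euclidean.
Context (R : realType) (d : nat).
Implicit Types x y : d.-tuple R.

Definition dotp x y : R := \sum_(i < d) tnth x i * tnth y i.

Definition enorm x : R := Num.sqrt (dotp x x).

Definition scalet (c : R) x : d.-tuple R := [tuple c * tnth x i | i < d].

Definition eball (r : R) : set (d.-tuple R) := [set x | enorm x < r].

(* m_alpha(x) = (1 - |x|^2)_+^alpha *)
Definition bochner_riesz (alpha : R) x : R :=
  if enorm x < 1 then (1 - enorm x ^+ 2) `^ alpha else 0.

End euclidean.

Section complex_integral.
Context disp (T : measurableType disp) (R : realType).
Variable mu : {measure set T -> \bar R}.

Definition cintegrable (f : T -> R[i]) : Prop :=
  mu.-integrable setT (fun x => (complex.Re (f x))%:E) /\
  mu.-integrable setT (fun x => (complex.Im (f x))%:E).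

Definition cintegral (f : T -> R[i]) : R[i] :=
  (\int[mu]_x complex.Re (f x)) +i* (\int[mu]_x complex.Im (f x)).

End complex_integral.

Section fourier_and_rearrangement.
Context (R : realType) (d : nat).
Local Notation mu := (lebesgue_tuple R d).

Definition expi (theta : R) : R[i] := cos theta +i* sin theta.

Definition fourier (phi : d.-tuple R -> R[i]) (xi : d.-tuple R) : R[i] :=
  cintegral mu (fun t => phi t * expi (- (2 * pi * dotp t xi))).

(* For d >= 1 and E of finite measure the radius exists and is unique. *)
Definition symm_set (E : set (d.-tuple R)) : set (d.-tuple R) :=
  eball (xget 0 [set r : R | 0 <= r /\ mu (eball r) = mu E]).

(* For integrable phi the integral over lambda is infinite at most at x = 0, where the
   real-valued integral is then 0: a null set when d >= 1. *)
Definition symm_rearr (phi : d.-tuple R -> R[i]) (x : d.-tuple R) : R :=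
  \int[lebesgue_measure]_(lambda in `]0, +oo[)
    \1_(symm_set [set y | lambda < Normc.normc (phi y)]) x.

End fourier_and_rearrangement.

(* Main.v *)
Require Import Defs.
From mathcomp Require Import all_boot all_order all_algebra.
From mathcomp Require Import all_classical all_reals all_analysis.
From mathcomp Require Import complex.
From mathcomp Require Import measurable_realfun.
From mathcomp Require Import ring lra.

Set Implicit Arguments.
Unset Strict Implicit.
Unset Printing Implicit Defensive.

Import Order.TTheory GRing.Theory Num.Theory.
Import numFieldNormedType.Exports.

Local Open Scope classical_set_scope.
Local Open Scope ring_scope.
Local Open Scope complex_scope.

(* By Fubini, pairing the kernel w(xi) = Omega^-d m_alpha(xi / Omega) with the
   Fourier transform of phi gives the integral of phi(t) M(Omega t), where M is
   the cosine transform of m_alpha. M is radial, it decreases on a small ball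
   since y |-> cos(y |xi|) does there, and away from the origin |M| stays below
   M(0) by a fixed amount; by continuity at 0 there is r > 0 such that
   |M(t)| <= M(s) whenever |s| <= r and |s| <= |t|. If Omega S^(1/d) is small,
   the balls with the measures of the level sets of |phi| lie in
   {Omega |s| <= r}, so the bathtub principle applied to each level set,
   together with the layer-cake formula, bounds the integral of
   |phi(t)| |M(Omega t)| by that of |phi|^*(t) M(Omega t). *)

(** * The Euclidean space of tuples *)

(** No closed form or decay estimate of M enters. The gap away from the origin comes from
    integrating the nonnegative factors 1 - cos and 1 + cos against m_alpha: a translation by half a
    period bounds M(0) - M(t) below for |t| >= 2, and the duplication formula of the cosine carries
    this bound down to |t| >= 1/8 and over to M(0) + M(t). Of m_alpha this uses only that it is
    nonnegative, integrable, radial, supported in the unit ball and bounded below near 0; alpha >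
    -1/2 serves integrability near the unit sphere. As M may change sign, the comparison is made
    with |M|; the rearrangement lives on a ball where M = |M|. Radiality of M rests on the
    invariance of Lebesgue measure under hyperplane reflections, which an iterated product does not
    display; a uniqueness argument of Haar type supplies it. Reflections suffice, since one of them
    exchanges any two given vectors of equal norm. *)

Section tuple_space.
Context {R : realType} {n : nat}.
Implicit Types x y z : n.-tuple R.

Definition addt x y : n.-tuple R := [tuple tnth x i + tnth y i | i < n].

Lemma tnth_addt x y i : tnth (addt x y) i = tnth x i + tnth y i.
Proof. by rewrite tnth_mktuple. Qed.

Lemma tnth_scalet c x i : tnth (scalet c x) i = c * tnth x i.
Proof. by rewrite tnth_mktuple. Qed.

Lemma addtC x y : addt x y = addt y x.
Proof. by apply: eq_from_tnth => i; rewrite !tnth_addt addrC. Qed.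

Lemma addtK x y : addt (addt x y) (scalet (-1) y) = x.
Proof.
by apply: eq_from_tnth => i; rewrite !(tnth_addt, tnth_scalet) mulN1r addrK.
Qed.

Lemma scaletA a b x : scalet a (scalet b x) = scalet (a * b) x.
Proof. by apply: eq_from_tnth => i; rewrite !tnth_scalet mulrA. Qed.

Lemma scale1t x : scalet 1 x = x.
Proof. by apply: eq_from_tnth => i; rewrite tnth_scalet mul1r. Qed.

Lemma scaletDr c x y : scalet c (addt x y) = addt (scalet c x) (scalet c y).
Proof.
by apply: eq_from_tnth => i; rewrite !(tnth_addt, tnth_scalet) mulrDr.
Qed.

Lemma dotpC x y : dotp x y = dotp y x.
Proof. by apply: eq_bigr => i _; rewrite mulrC. Qed.

Lemma dotpDl x y z : dotp (addt x y) z = dotp x z + dotp y z.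
Proof.
by rewrite -big_split; apply: eq_bigr => i _; rewrite tnth_addt mulrDl.
Qed.

Lemma dotpDr x y z : dotp z (addt x y) = dotp z x + dotp z y.
Proof. by rewrite dotpC dotpDl !(dotpC z). Qed.

Lemma dotpZl c x y : dotp (scalet c x) y = c * dotp x y.
Proof.
by rewrite mulr_sumr; apply: eq_bigr => i _; rewrite tnth_scalet mulrA.
Qed.

Lemma dotpZr c x y : dotp x (scalet c y) = c * dotp x y.
Proof. by rewrite dotpC dotpZl dotpC. Qed.

Lemma dotpxx_ge0 x : 0 <= dotp x x.
Proof. by apply: sumr_ge0 => i _; rewrite -expr2 sqr_ge0. Qed.

Lemma dotpxx_eq0 x y : dotp x x = 0 -> dotp x y = 0.
Proof.
move=> /eqP; rewrite psumr_eq0 => [/allP x0|i _]; last first.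
  by rewrite -expr2 sqr_ge0.
apply: big1 => i _; have := x0 i (mem_index_enum _).
by rewrite mulf_eq0 orbb => /eqP ->; rewrite mul0r.
Qed.

Lemma enorm_ge0 x : 0 <= enorm x.
Proof. exact: sqrtr_ge0. Qed.

Lemma enorm_sqr x : enorm x ^+ 2 = dotp x x.
Proof. by rewrite sqr_sqrtr// dotpxx_ge0. Qed.

Lemma enormZ c x : enorm (scalet c x) = `|c| * enorm x.
Proof.
by rewrite /enorm dotpZl dotpZr mulrA -expr2 sqrtrM ?sqr_ge0// sqrtr_sqr.
Qed.

Lemma cauchy_schwarz x y : `|dotp x y| <= enorm x * enorm y.
Proof.
rewrite -(@ler_pXn2r _ 2)// ?nnegrE ?mulr_ge0 ?enorm_ge0//.
rewrite exprMn !enorm_sqr real_normK ?num_real//.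
have [y0|y0] := eqVneq (dotp y y) 0.
  by rewrite y0 dotpC (dotpxx_eq0 _ y0) expr0n mulr0.
have y_gt0 : 0 < dotp y y by rewrite lt_def y0 dotpxx_ge0.
(* The square of |y|^2 x - <x,y> y expands to |y|^2 (|x|^2 |y|^2 - <x,y>^2). *)
have := dotpxx_ge0 (addt (scalet (dotp y y) x) (scalet (- dotp x y) y)).
rewrite !(dotpDl, dotpDr, dotpZl, dotpZr) (dotpC y x) => h.
rewrite -subr_ge0 -(pmulr_rge0 _ y_gt0); move: h; congr (_ <= _); ring.
Qed.

Lemma ler_enormD x y : enorm (addt x y) <= enorm x + enorm y.
Proof.
rewrite -(@ler_pXn2r _ 2)// ?nnegrE ?addr_ge0 ?enorm_ge0//.
rewrite sqrrD !enorm_sqr !(dotpDl, dotpDr) (dotpC y x).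
have := le_trans (ler_norm _) (cauchy_schwarz x y); lra.
Qed.

(** Definiteness of the norm, put as invariance under scaling so that no zero tuple has to be
    named. *)
Lemma enorm0_scalet0 x c : enorm x = 0 -> scalet c x = x.
Proof.
move=> x0; have : dotp x x == 0 by rewrite -enorm_sqr x0 expr0n.
rewrite psumr_eq0 => [/allP z|i _]; last by rewrite -expr2 sqr_ge0.
apply: eq_from_tnth => i; have := z i (mem_index_enum _).
by rewrite mulf_eq0 orbb tnth_scalet => /eqP ->; rewrite mulr0.
Qed.

End tuple_space.

Section measurable_tuple_space.
Context {R : realType}.

Lemma measurable_addt d (T : measurableType d) n (f g : T -> n.-tuple R) :
  measurable_fun setT f -> measurable_fun setT g ->
  measurable_fun setT (fun t => addt (f t) (g t)).
Proof.
move=> /measurable_fun_tnthP mf /measurable_fun_tnthP mg.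
apply/measurable_fun_tnthP => i.
rewrite (_ : _ \o _ = fun t => tnth (f t) i + tnth (g t) i); last first.
  by apply/funext => t /=; rewrite tnth_addt.
by apply: measurable_funD; [exact: mf | exact: mg].
Qed.

Lemma measurable_scalet d (T : measurableType d) n (c : T -> R)
    (f : T -> n.-tuple R) :
  measurable_fun setT c -> measurable_fun setT f ->
  measurable_fun setT (fun t => scalet (c t) (f t)).
Proof.
move=> mc /measurable_fun_tnthP mf.
apply/measurable_fun_tnthP => i.
rewrite (_ : _ \o _ = fun t => c t * tnth (f t) i); last first.
  by apply/funext => t /=; rewrite tnth_scalet.
by apply: measurable_funM => //; exact: mf.
Qed.

Lemma measurable_dotp d (T : measurableType d) n (f g : T -> n.-tuple R) :
  measurable_fun setT f -> measurable_fun setT g ->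
  measurable_fun setT (fun t => dotp (f t) (g t)).
Proof.
move=> /measurable_fun_tnthP mf /measurable_fun_tnthP mg.
by apply: measurable_sum => i; apply: measurable_funM; [exact: mf | exact: mg].
Qed.

Lemma measurable_enorm d (T : measurableType d) n (f : T -> n.-tuple R) :
  measurable_fun setT f -> measurable_fun setT (fun t => enorm (f t)).
Proof.
move=> mf; have msqrt : measurable_fun setT (@Num.sqrt R).
  by apply: continuous_measurable_fun; exact: sqrt_continuous.
exact: (measurableT_comp msqrt (measurable_dotp mf mf)).
Qed.

Lemma measurable_eball n (r : R) : measurable (@eball R n r).
Proof.
rewrite -[eball r]setTI.
have : measurable_fun setT (fun x : n.-tuple R => enorm x < r).
  by apply: measurable_fun_ltr => //; exact: measurable_enorm.
by move=> /(_ measurableT [set true]); apply.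
Qed.

End measurable_tuple_space.

(** * Invariance properties of Lebesgue measure *)

Section lebesgue_tuple_integral.
Context {R : realType}.
Local Open Scope ereal_scope.
Local Notation leb := (@lebesgue_measure R).

Let RM := measurableTypeR R.

(** Lebesgue measure is determined by its values on half-open intervals, and its pushforward under
    the shift has the same values there. *)
Lemma ge0_integral_leb_shift (v : R) (f : RM -> \bar R) :
  measurable_fun setT f -> (forall x, 0 <= f x) ->
  \int[leb]_x f (x + v)%R = \int[leb]_x f x.
Proof.
move=> mf f0.
have mphi : measurable_fun [set: RM] (fun x : RM => (x + v)%R : RM).
  exact: measurable_funD.
pose phi (x : RM) : RM := (x + v)%R.
transitivity (\int[pushforward leb phi]_x f x).
  by rewrite (ge0_integral_pushforward mphi).
apply: eq_measure_integral => A mA _.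
apply/esym/lebesgue_measure_unique => //= _ [[a b]] _ <-.
rewrite /pushforward (_ : _ @^-1` _ = `](a - v)%R, (b - v)%R]%classic).
  rewrite !lebesgue_measure_itv/= !lte_fin ltrD2r.
  by case: ifP => // _; rewrite !EFinN -EFinD; congr EFin; ring.
by apply/seteqP; split=> x /=; rewrite !in_itv/= ltrBlDr lerBrDr.
Qed.

Lemma ge0_integral_leb_scale (c : R) (f : RM -> \bar R) : (0 < c)%R ->
  measurable_fun setT f -> (forall x, 0 <= f x) ->
  c%:E * \int[leb]_x f (c * x)%R = \int[leb]_x f x.
Proof.
move=> c0 mf f0.
have mphi : measurable_fun [set: RM] (fun x : RM => (c * x)%R : RM).
  exact: measurable_funM.
pose phi (x : RM) : RM := (c * x)%R.
pose cc : {nonneg R} := NngNum (ltW c0).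
pose nu : {measure set RM -> \bar R} := pushforward leb phi.
transitivity (c%:E * \int[nu mphi]_x f x).
  by rewrite (ge0_integral_pushforward mphi).
transitivity (\int[mscale cc (nu mphi)]_x f x).
  by rewrite ge0_integral_mscale.
apply: eq_measure_integral => A mA _.
apply/esym/lebesgue_measure_unique => //= _ [[a b]] _ <-.
change (leb `]a, b]%classic = c%:E * leb (phi @^-1` `]a, b]%classic)).
rewrite (_ : phi @^-1` _ = `](a / c)%R, (b / c)%R]%classic).
  rewrite !lebesgue_measure_itv/= !lte_fin ltr_pM2r ?invr_gt0//.
  case: ifP => // _; last by rewrite mule0.
  by rewrite -!EFinB -EFinM; congr EFin; field; rewrite gt_eqF.
apply/seteqP; split=> x /=; rewrite !in_itv/=.
  by rewrite ltr_pdivrMr// ler_pdivlMr// !(mulrC x).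
by rewrite ltr_pdivrMr// ler_pdivlMr// !(mulrC x).
Qed.

(** Tonelli for one split-off coordinate: it is the induction step that lifts invariances from the
    line to all dimensions. *)
Lemma ge0_integral_lebesgue_cons n
    (m : {sigma_finite_measure set (n.-tuple R) -> \bar R})
    (f : n.+1.-tuple R -> \bar R) :
  measurable_fun setT f -> (forall x, 0 <= f x) ->
  \int[lebesgue_cons m]_x f x = \int[leb]_x \int[m]_t f [tuple of x :: t].
Proof.
move=> mf f0.
have mphi : measurable_fun [set: RM * n.-tuple R]
    (fun p => [tuple of (p.1 : R) :: p.2]).
  exact: measurable_cons.
have mfphi : measurable_fun [set: RM * n.-tuple R]
    (fun p => f [tuple of (p.1 : R) :: p.2]).
  exact: (measurableT_comp mf mphi).
rewrite -(fubini_tonelli1 (fun p : RM * n.-tuple R =>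
  f [tuple of (p.1 : R) :: p.2]))//.
transitivity (\int[pushforward (leb \x m)
    (fun p : RM * n.-tuple R => [tuple of (p.1 : R) :: p.2])]_x f x).
  exact: eq_measure_integral.
by rewrite (ge0_integral_pushforward mphi).
Qed.

Lemma measurable_integral_cons n
    (m : {sigma_finite_measure set (n.-tuple R) -> \bar R})
    (f : n.+1.-tuple R -> \bar R) :
  measurable_fun setT f -> (forall x, 0 <= f x) ->
  measurable_fun [set: RM] (fun x : RM => \int[m]_t f [tuple of x :: t]).
Proof.
move=> mf f0.
apply: (measurable_fun_fubini_tonelli_F (fun p : RM * n.-tuple R =>
  f [tuple of (p.1 : R) :: p.2])) => //.
by apply: (measurableT_comp mf); exact: measurable_cons.
Qed.

Lemma ge0_integral_addt n (v : n.-tuple R) (f : n.-tuple R -> \bar R) :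
  measurable_fun setT f -> (forall x, 0 <= f x) ->
  \int[lebesgue_tuple R n]_x f (addt x v) = \int[lebesgue_tuple R n]_x f x.
Proof.
elim: n => [|n IHn] in v f *; move=> mf f0.
  by apply: eq_integral => x _; rewrite (tuple0 (addt x v)) (tuple0 x).
have mfv : measurable_fun setT (fun x => f (addt x v)).
  by apply: (measurableT_comp mf); exact: measurable_addt.
rewrite /= !ge0_integral_lebesgue_cons//.
pose g x := \int[lebesgue_tuple R n]_t f [tuple of x :: t].
rewrite -[RHS](@ge0_integral_leb_shift (thead v) g); first last.
- by move=> x; exact: integral_ge0.
- exact: measurable_integral_cons.
apply: eq_integral => x _; rewrite /g.
have mfx : measurable_fun setT
    (fun t : n.-tuple R => f [tuple of (x + thead v)%R :: t]).
  by apply: (measurableT_comp mf); exact: measurable_cons.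
rewrite -[RHS](IHn [tuple of behead v])//; apply: eq_integral => t _.
congr f; apply: eq_from_tnth => i; rewrite tnth_addt.
case: (unliftP ord0 i) => [j|] ->; last by rewrite !tnth0.
by rewrite [in LHS](tuple_eta v) !tnthS tnth_addt.
Qed.

Lemma ge0_integral_scalet n (c : R) (f : n.-tuple R -> \bar R) : (0 < c)%R ->
  measurable_fun setT f -> (forall x, 0 <= f x) ->
  (c ^+ n)%:E * \int[lebesgue_tuple R n]_x f (scalet c x) =
  \int[lebesgue_tuple R n]_x f x.
Proof.
move=> c0; elim: n => [|n IHn] in f *; move=> mf f0.
  rewrite expr0 mul1e.
  by apply: eq_integral => x _; rewrite (tuple0 (scalet _ _)) (tuple0 x).
have mfc : measurable_fun setT (fun x => f (scalet c x)).
  by apply: (measurableT_comp mf); exact: measurable_scalet.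
rewrite /= !ge0_integral_lebesgue_cons//.
pose g x := \int[lebesgue_tuple R n]_t f [tuple of x :: t].
have mg : measurable_fun [set: RM] g by exact: measurable_integral_cons.
have g0 x : 0 <= g x by exact: integral_ge0.
rewrite -[RHS](@ge0_integral_leb_scale c g)// exprS EFinM -muleA; congr *%E.
rewrite -ge0_integralZl_EFin ?exprn_ge0 ?(ltW c0)//; first last.
- exact: (@measurable_integral_cons _ (lebesgue_tuple R n)
    (fun x => f (scalet c x)) mfc (fun x => f0 _)).
- by move=> x _; exact: integral_ge0.
apply: eq_integral => x _; rewrite /g.
have mfx : measurable_fun setT
    (fun t : n.-tuple R => f [tuple of (c * x)%R :: t]).
  by apply: (measurableT_comp mf); exact: measurable_cons.
rewrite -[RHS]IHn//; congr *%E; apply: eq_integral => t _.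
congr f; apply: eq_from_tnth => i; rewrite tnth_scalet.
case: (unliftP ord0 i) => [j|] ->; first by rewrite !tnthS tnth_scalet.
by rewrite !tnth0.
Qed.

Lemma measurable_cube n (a : R) :
  measurable [set x : n.-tuple R | forall i, (`|tnth x i| <= a)%R].
Proof.
rewrite [X in measurable X](_ : _ =
    \bigcap_(i in [set: 'I_n]) [set x : n.-tuple R | (`|tnth x i| <= a)%R]).
  apply: fin_bigcap_measurable => // i _.
  rewrite -[X in measurable X]setTI.
  have : measurable_fun setT (fun x : n.-tuple R => (`|tnth x i| <= a)%R).
    apply: measurable_fun_ler => //; apply: measurableT_comp => //.
    exact: measurable_tnth.
  by move=> /(_ measurableT [set true]); apply.
by apply/seteqP; split=> x /= h i; [move=> _|]; exact: h.
Qed.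

Lemma lebesgue_tuple_cube n (a : R) : (0 < a)%R ->
  lebesgue_tuple R n [set x | forall i, (`|tnth x i| <= a)%R] =
  ((2 * a) ^+ n)%:E.
Proof.
move=> a0; elim: n => [|n IHn].
  rewrite expr0 /= diracE mem_set// => i; by case: i.
rewrite /= /lebesgue_cons /pushforward.
rewrite (_ : _ @^-1` _ =
    `[(- a)%R, a]%classic `*`
    [set x : n.-tuple R | forall i, (`|tnth x i| <= a)%R]).
  rewrite product_measure1E//.
    rewrite [X in _ * X]IHn exprS EFinM; congr *%E.
    change (leb `[(- a)%R, a]%classic = (2 * a)%:E).
    rewrite lebesgue_measure_itv/= lte_fin gtrN// -EFinB; congr EFin; ring.
  exact: measurable_cube.
apply/seteqP; split=> -[x t] /=.
  move=> h; split; first by have := h ord0; rewrite tnth0 in_itv/= ler_norml.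
  by move=> i; have := h (lift ord0 i); rewrite tnthS.
rewrite in_itv/= -ler_norml => -[hx ht] i.
by case: (unliftP ord0 i) => [j|] ->; rewrite ?tnthS ?tnth0.
Qed.

End lebesgue_tuple_integral.

Section lebesgue_tuple_geometry.
Context {R : realType} {n : nat}.
Local Open Scope ereal_scope.
Local Notation mu := (lebesgue_tuple R n).
Implicit Types (x y : n.-tuple R) (f : n.-tuple R -> \bar R).

Lemma in_eball x r : (x \in eball r) = (enorm x < r)%R.
Proof. by apply/idP/idP; rewrite inE. Qed.

Lemma eball1_measure_gt0 : 0 < mu (eball 1).
Proof.
(* A cube of this half-side fits into the open unit ball: n a^2 <= n a = n / (n + 1) < 1. *)
pose a : R := (n.+1%:R^-1)%R.
have a0 : (0 < a)%R by rewrite invr_gt0 ltr0n.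
have mB : measurable [set x : n.-tuple R | forall i, (`|tnth x i| <= a)%R].
  exact: measurable_cube.
apply: (@lt_le_trans _ _ (mu [set x | forall i, (`|tnth x i| <= a)%R])).
  by rewrite lebesgue_tuple_cube// lte_fin exprn_gt0// mulr_gt0.
apply: le_measure; rewrite ?inE//; first exact: measurable_eball.
move=> x /= xa; rewrite /eball /= -(@ltr_pXn2r _ 2)// ?nnegrE ?enorm_ge0//.
rewrite expr1n enorm_sqr.
apply: (@le_lt_trans _ _ (\sum_(i < n) a)%R).
  apply: ler_sum => i _; rewrite -expr2 -real_normK ?num_real//.
  have xi := xa i; rewrite expr2 (le_trans (ler_pM _ _ xi xi))//.
  by rewrite ger_pMr// invf_le1// ler1n.
rewrite sumr_const card_ord -mulr_natl ltr_pdivrMr ?ltr0n// mul1r.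
by rewrite ltr_nat.
Qed.

Lemma eball1_measure_lty : mu (eball 1) < +oo.
Proof.
have mB : measurable [set x : n.-tuple R | forall i, (`|tnth x i| <= 1)%R].
  exact: measurable_cube.
apply: (@le_lt_trans _ _ (mu [set x | forall i, (`|tnth x i| <= 1)%R])).
  apply: le_measure; rewrite ?inE//; first exact: measurable_eball.
  move=> x /= x1 i; rewrite (le_trans _ (ltW x1))//.
  rewrite -(@ler_pXn2r _ 2)// ?nnegrE ?enorm_ge0//.
  rewrite real_normK ?num_real// enorm_sqr /dotp (bigD1 i)//= -expr2.
  by rewrite lerDl sumr_ge0// => j _; rewrite -expr2 sqr_ge0.
by rewrite lebesgue_tuple_cube// ltry.
Qed.

(* The uniqueness argument for Haar measure: with B the unit ball and V its
   measure, translation invariance and Tonelli turn [V * \int f (U x) dx] into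
   [\int\int f (U x + y) 1_B(y) = \int\int f(y) 1_B(y - U x)], and the inner
   integral over x of [1_B(y - U x) = 1_B(x - U y)] is V. *)
Lemma ge0_integral_isometry (U : n.-tuple R -> n.-tuple R) f :
  measurable_fun setT U -> {morph U : x y / addt x y} -> involutive U ->
  (forall x, enorm (U x) = enorm x) ->
  measurable_fun setT f -> (forall x, 0 <= f x) ->
  \int[mu]_x f (U x) = \int[mu]_x f x.
Proof.
move=> mU UD UK Un mf f0.
pose b x : \bar R := (\1_(eball 1) x)%:E.
have b0 x : 0 <= b x by rewrite lee_fin.
have mb : measurable_fun setT b.
  by apply/measurable_EFinP; apply: measurable_indic; exact: measurable_eball.
have intb : \int[mu]_x b x = mu (eball 1).
  by rewrite integral_indic ?setIT//; exact: measurable_eball.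
have mfU : measurable_fun setT (f \o U) by exact: measurableT_comp.
have VE c : 0 <= c -> \int[mu]_y (c * b y) = c * mu (eball 1).
  by move=> c0; rewrite ge0_integralZl// ?intb.
suff : (\int[mu]_x f (U x)) * mu (eball 1) = (\int[mu]_x f x) * mu (eball 1).
  have V0 := eball1_measure_gt0; have Voo := eball1_measure_lty.
  move: V0 Voo; case: (mu (eball 1)) => [v| |]//; rewrite lte_fin => v0 _ h.
  have := congr1 (fun z => z * (v^-1)%:E) h.
  by rewrite -!muleA -EFinM divff ?gt_eqF// !mule1.
have shiftE y : \int[mu]_x f (U x) = \int[mu]_x f (addt (U x) y).
  rewrite -(ge0_integral_addt (U y) mfU)//; last by move=> x; exact: f0.
  by apply: eq_integral => x _ /=; rewrite UD UK.
rewrite -VE; last exact: integral_ge0.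
transitivity (\int[mu]_y \int[mu]_x (f (addt (U x) y) * b y)).
  apply: eq_integral => y _; rewrite (shiftE y) ge0_integralZr//.
  by apply: (measurableT_comp mf); exact: measurable_addt.
rewrite -(fubini_tonelli (fun p => f (addt (U p.1) p.2) * b p.2)); first last.
- by move=> p; exact: mule_ge0.
- apply: emeasurable_funM; last exact: measurableT_comp.
  apply: (measurableT_comp mf); apply: measurable_addt => //.
  exact: measurableT_comp.
pose g x y := f y * b (addt y (scalet (-1) (U x))).
transitivity (\int[mu]_x \int[mu]_y g x y).
  apply: eq_integral => x _ /=.
  rewrite -(@ge0_integral_addt _ _ (U x) (g x)).
  - by apply: eq_integral => y _; rewrite /g addtK addtC.
  - apply: emeasurable_funM => //; apply: (measurableT_comp mb).
    exact: measurable_addt.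
  - by move=> y; exact: mule_ge0.
rewrite (fubini_tonelli (fun p => g p.1 p.2)); first last.
- by move=> p; exact: mule_ge0.
- apply: emeasurable_funM; first exact: measurableT_comp.
  apply: (measurableT_comp mb); apply: measurable_addt => //.
  apply: measurable_scalet => //; exact: measurableT_comp.
rewrite -ge0_integralZr//=.
apply: eq_integral => y _; rewrite /g /= ge0_integralZl//; last first.
  apply: (measurableT_comp mb); apply: measurable_addt => //.
  exact: measurable_scalet.
congr *%E; rewrite -intb -(ge0_integral_addt (scalet (-1) (U y)) mb)//.
apply: eq_integral => x _; congr (_%:E).
rewrite !indicE; congr (_%:R); congr nat_of_bool.
(* [U] sends y - U x to U y - x, the opposite of x - U y, and preserves the norm. *)
suff : enorm (addt y (scalet (-1) (U x))) = enorm (addt x (scalet (-1) (U y))).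
  by rewrite !in_eball => ->.
(* Only additivity of [U] is assumed, not homogeneity: |U 0| = 0 gives U 0 = 0, hence [U] commutes
   with negation. Here [scalet 0 z] stands for the zero vector. *)
have UZ z : U (scalet (-1) z) = scalet (-1) (U z).
  have U0 : addt z (scalet (-1) z) = scalet 0 z.
    apply: eq_from_tnth => i; rewrite !(tnth_addt, tnth_scalet); ring.
  have : addt (U (scalet (-1) z)) (U z) = U (scalet 0 z).
    by rewrite -UD addtC U0.
  have -> : U (scalet 0 z) = scalet 0 z.
    apply: (@etrans _ _ (scalet 0 (U (scalet 0 z)))).
      by rewrite [RHS]enorm0_scalet0// Un enormZ normr0 mul0r.
    by apply: eq_from_tnth => i; rewrite !tnth_scalet !mul0r.
  move=> /(congr1 (fun t => addt t (scalet (-1) (U z)))); rewrite addtK => ->.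
  by apply: eq_from_tnth => i; rewrite !(tnth_addt, tnth_scalet); ring.
have NE z : enorm z = enorm (scalet (-1) z) by rewrite enormZ normrN1 mul1r.
by rewrite -Un UD UZ UK NE scaletDr scaletA mulrNN mulr1 scale1t addtC.
Qed.

Lemma measure_eball r : (0 <= r)%R ->
  (0 < n)%N -> mu (eball r) = (r ^+ n)%:E * mu (eball 1).
Proof.
(* At r = 0 the ball is empty while 0^0 = 1, so a positive dimension is required. *)
rewrite le_eqVlt => /predU1P[<-|r0] n0.
  rewrite expr0n gtn_eqF// mul0e (_ : eball 0 = set0) ?measure0//.
  by apply/seteqP; split=> x //=; rewrite /eball/= ltNge enorm_ge0.
transitivity (\int[mu]_x (\1_(eball r) x)%:E).
  by rewrite integral_indic ?setIT//; exact: measurable_eball.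
rewrite -(@ge0_integral_scalet _ _ r)//; last first.
  by apply/measurable_EFinP; apply: measurable_indic; exact: measurable_eball.
congr *%E; transitivity (\int[mu]_x (\1_(eball 1) x)%:E); last first.
  by rewrite integral_indic ?setIT//; exact: measurable_eball.
apply: eq_integral => x _; congr (_%:E).
rewrite !indicE; congr (_%:R); congr nat_of_bool.
rewrite !in_eball enormZ gtr0_norm// -[X in (_ < X)%R](mulr1 r).
by rewrite ltr_pM2l.
Qed.

End lebesgue_tuple_geometry.

(** Splitting into positive and negative parts carries a change of variables from nonnegative
    extended integrands to real integrable ones. It is applied with c = 1 to isometries and with a
    power of the ratio to dilations. *)
Lemma Rintegral_comp_scaled d (T : measurableType d) (R : realType)
    (mu : {measure set T -> \bar R}) (c : R) (U : T -> T) (f : T -> R) :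
  0 < c -> measurable_fun setT U ->
  (forall g : T -> \bar R, measurable_fun setT g -> (forall x, (0 <= g x)%E) ->
    (c%:E * \int[mu]_x g (U x) = \int[mu]_x g x)%E) ->
  mu.-integrable setT (EFin \o f) ->
  mu.-integrable setT (EFin \o (f \o U)) /\
  c * (\int[mu]_x f (U x)) = \int[mu]_x f x.
Proof.
move=> c0 mU Uc intf; have [mf foo] := integrableP _ _ _ intf.
have intfU : mu.-integrable setT (EFin \o (f \o U)).
  apply/integrableP; split; first exact: (measurableT_comp mf).
  have mabs : measurable_fun setT (abse \o (EFin \o f)).
    exact: measurableT_comp.
  rewrite ltey; apply/eqP => fUoo; move: foo.
  by rewrite -(Uc (abse \o (EFin \o f)))//= fUoo gt0_muley.
split=> //; rewrite /Rintegral.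
have -> : c = fine c%:E by [].
rewrite -fineM//; last exact: integrable_fin_num.
congr fine; rewrite integralE [in RHS]integralE muleBr//; last first.
  by rewrite fin_num_adde_defr// integrable_pos_fin_num.
congr (_ - _)%E.
  rewrite -(Uc (EFin \o f)^\+%E)//; last exact: measurable_funepos.
  by congr *%E; apply: eq_integral => x _; rewrite !funeposE.
rewrite -(Uc (EFin \o f)^\-%E)//; last exact: measurable_funeneg.
by congr *%E; apply: eq_integral => x _; rewrite !funenegE.
Qed.

(** * Integrability of the Bochner-Riesz multiplier *)

Lemma bernoulli_ineq {R : realFieldType} (n : nat) (e : R) :
  0 <= e <= 1 -> 1 - n%:R * e <= (1 - e) ^+ n.
Proof.
move=> /andP[e0 e1]; elim: n => [|n IHn]; first by rewrite mul0r subr0 expr0.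
rewrite exprS -natr1; apply: (le_trans _ (ler_wpM2l _ IHn)); last lra.
rewrite -subr_ge0 (_ : _ - _ = n%:R * e ^+ 2); last by ring.
by rewrite mulr_ge0// sqr_ge0.
Qed.

Section bochner_riesz_integrable.
Context {R : realType} {n : nat} (alpha : R).
Hypotheses (n_gt0 : (0 < n)%N) (alphaN2 : - (1 / 2) < alpha).
Local Notation mu := (lebesgue_tuple R n).

Lemma bochner_riesz_ge0 (x : n.-tuple R) : 0 <= bochner_riesz alpha x.
Proof. by rewrite /bochner_riesz; case: ifP => // _; exact: powR_ge0. Qed.

Lemma measurable_bochner_riesz :
  measurable_fun setT (bochner_riesz alpha : n.-tuple R -> R).
Proof.
apply: measurable_fun_ifT => //=.
- by apply: measurable_fun_ltr => //; exact: measurable_enorm.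
- have mu1 : measurable_fun setT (fun x : n.-tuple R => 1 - enorm x ^+ 2).
    apply: measurable_funB => //; apply: measurable_funX.
    exact: measurable_enorm.
  exact: (measurableT_comp (@measurable_powR R alpha) mu1).
Qed.

(** By homogeneity the shell has measure (1 - (1 - e)^n) |B(0,1)|, and Bernoulli's inequality bounds
    the first factor by n e. *)
Lemma measure_shell (e : R) : 0 <= e <= 1 ->
  (mu (eball 1 `\` eball (1 - e)%R) <= (n%:R * e)%:E * mu (eball 1))%E.
Proof.
move=> /andP[e0 e1].
have mB r : measurable (eball r : set (n.-tuple R)) by exact: measurable_eball.
have -> : (mu (eball 1 `\` eball (1 - e)%R) =
    mu (eball 1) - mu (eball (1 - e)%R))%E.
  rewrite measureD//; last exact: eball1_measure_lty.
  rewrite setIidr// => x; rewrite /eball/= => /lt_le_trans; apply; lra.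
rewrite (measure_eball (r := 1 - e)) ?subr_ge0//.
have := eball1_measure_lty (R := R) (n := n).
have := eball1_measure_gt0 (R := R) (n := n).
case: (mu (eball 1)) => [v| |]//; rewrite lte_fin => v0 _.
rewrite -!EFinM -EFinB lee_fin -{1}(mul1r v) -mulrBl ler_pM2r//.
by have := @bernoulli_ineq R n e; rewrite e0 e1 => /(_ isT); lra.
Qed.

(** The base 1 - |x|^2 lies in ]0, 1], so lowering the exponent from alpha to -1/2 increases the
    power; then 1 - |x|^2 >= 1 - |x|. *)
Lemma bochner_riesz_le_invsqrt (x : n.-tuple R) : enorm x < 1 ->
  bochner_riesz alpha x <= (Num.sqrt (1 - enorm x))^-1.
Proof.
move=> x1; rewrite /bochner_riesz x1.
have aN2 : - 2^-1 <= alpha by rewrite -div1r ltW.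
have x0 := enorm_ge0 x.
have u1 : 1 - enorm x <= 1 - enorm x ^+ 2.
  by rewrite lerD2l lerN2 expr2 ler_piMl// ltW.
have u0 : 0 < 1 - enorm x by lra.
have : 1 - enorm x ^+ 2 <= 1 by rewrite lerBlDr lerDl sqr_ge0.
move: u1; move: (1 - enorm x ^+ 2) => u ue u1.
apply: (@le_trans _ _ (u `^ (- 2^-1))).
  by apply: ger_powR; [rewrite u1 andbT (lt_le_trans u0 ue)|].
have u_gt0 : 0 < u := lt_le_trans u0 ue.
rewrite powRN powR12_sqrt; last exact: ltW.
by rewrite lef_pV2 ?posrE ?sqrtr_gt0 ?ler_sqrt// ltW.
Qed.

(* Dyadic decomposition of the unit ball into the shells
   [1 - |x| <= 4^-k], each of measure O(4^-k), on which the bound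
   [(1 - |x|)^(-1/2)] is [O(2^k)]. *)
Lemma integrable_bochner_riesz :
  mu.-integrable setT (EFin \o bochner_riesz alpha).
Proof.
apply/integrableP; split.
  by apply/measurable_EFinP; exact: measurable_bochner_riesz.
have mB r : measurable (eball r : set (n.-tuple R)) by exact: measurable_eball.
pose A k : set (n.-tuple R) := eball 1 `\` eball (1 - (4 ^+ k)^-1).
have mA k : measurable (A k) by exact: measurableD.
pose F k x : \bar R := ((2 ^+ k.+1)%:E * (\1_(A k) x)%:E)%E.
have F0 k x : (0 <= F k x)%E by rewrite mule_ge0// lee_fin ?exprn_ge0.
have mF k : measurable_fun setT (F k).
  apply: emeasurable_funM => //; apply/measurable_EFinP.
  exact: measurable_indic.
apply: (@le_lt_trans _ _ (\int[mu]_x (\sum_(k <oo) F k x))%E).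
  apply: ge0_le_integral => //=.
  - do 2 apply: measurableT_comp => //; exact: measurable_bochner_riesz.
  - apply: ge0_emeasurable_sum => //.
  move=> x _; rewrite ger0_norm ?bochner_riesz_ge0//.
  have [x1|x1] := ltP (enorm x) 1; last first.
    by rewrite /bochner_riesz ltNge x1 /=; exact: nneseries_ge0.
  have u0 : 0 < 1 - enorm x by lra.
  have x0 := enorm_ge0 x.
  have exK : exists K, (4 ^+ K)^-1 < 1 - enorm x.
    have [K _ hK] : exists2 K, true & (1 - enorm x)^-1 < K%:R.
      exists (Num.bound (1 - enorm x)^-1) => //.
      by rewrite archi_boundP// invr_ge0 ltW.
    exists K; rewrite invf_plt ?posrE ?exprn_gt0//.
    rewrite (lt_le_trans hK)// -natrX ler_nat; exact/ltnW/ltn_expl.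
  (* Minimality of k + 1 puts x into the shell [A k]: 4^-(k+1) < 1 - |x| <= 4^-k. The left
     inequality gives the height 2^(k+1) of [F k]. *)
  have [[|k] hk kmin] := ex_minnP exK.
    by exfalso; move: hk; rewrite expr0 invr1; lra.
  apply: (@le_trans _ _ (F k x)); last first.
    apply: le_trans (nneseries_lim_ge k.+1 _) => //.
    rewrite big_nat_recr//= leeDr//; exact: sume_ge0.
  rewrite /F -EFinM lee_fin indicE mem_set ?mulr1; last first.
    split=> //; rewrite /eball/= => hx.
    suff /kmin : (4 ^+ k)^-1 < 1 - enorm x by rewrite ltnn.
    lra.
  apply: (le_trans (bochner_riesz_le_invsqrt x1)).
  have s0 : 0 < Num.sqrt (1 - enorm x) by rewrite sqrtr_gt0.
  rewrite invf_ple ?posrE ?exprn_gt0//.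
  rewrite -(@ler_pXn2r _ 2)// ?nnegrE ?invr_ge0 ?exprn_ge0 ?sqrtr_ge0//.
  rewrite sqr_sqrtr ?(ltW u0)// exprVn -exprM mulnC exprM.
  by rewrite (_ : 2 ^+ 2 = 4 :> R) ?(ltW hk)// -natrX.
rewrite integral_nneseries//.
have := eball1_measure_lty (R := R) (n := n).
have := eball1_measure_gt0 (R := R) (n := n).
case E : (mu (eball 1)) => [v| |]//; rewrite lte_fin => v0 _.
(* Height times measure is at most 2^(k+1) n 4^-k v = r / 2^(k+1), a geometric series. *)
pose r := 4 * n%:R * v.
apply: (@le_lt_trans _ _ (\sum_(k <oo) (r / (2 ^ (k + 1))%:R)%:E)%E).
  apply: lee_nneseries => [k _ _|k _]; first exact: integral_ge0.
  have mI : measurable_fun setT (fun x => (\1_(A k) x : R)%:E).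
    by apply/measurable_EFinP; exact: measurable_indic.
  have p_ge0 : (0 <= (2 ^+ k.+1 : R)%:E)%E by rewrite lee_fin exprn_ge0.
  rewrite /F ge0_integralZl//.
  rewrite integral_indic// setIT.
  have h : 0 <= ((4 : R) ^+ k)^-1 <= 1.
    by rewrite invr_ge0 exprn_ge0//= invf_le1 ?exprn_gt0// exprn_ege1// ler1n.
  apply: (le_trans (lee_wpmul2l _ (measure_shell h))).
    by rewrite lee_fin exprn_ge0.
  rewrite E -!EFinM lee_fin /r natrX addn1 !exprS.
  rewrite (_ : 4 ^+ k = 2 ^+ k * 2 ^+ k :> R); last first.
    by rewrite -exprMn; congr (_ ^+ _); rewrite -natrM.
  have p0 : (2 : R) ^+ k != 0 by rewrite expf_neq0.
  by rewrite le_eqVlt; apply/orP; left; apply/eqP; field; rewrite p0.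
by rewrite (cvg_lim _ (cvg_geometric_eseries_half (r := r) (n := 0)))// ltry.
Qed.

End bochner_riesz_integrable.

(** * Cosine transforms of radial functions *)

Lemma integrable_mul_bounded d (T : measurableType d) (R : realType)
    (m : {measure set T -> \bar R}) (f g : T -> R) (C : R) :
  m.-integrable setT (EFin \o f) -> measurable_fun setT g ->
  (forall x, `|g x| <= C) ->
  m.-integrable setT (EFin \o (fun x => f x * g x)).
Proof.
move=> intf mg gC; apply: (integrableMl measurableT intf mg).
exists C; split; first exact: num_real.
by move=> M CM x _; exact: le_trans (gC x) (ltW CM).
Qed.

Section cosine_transform.
Context {R : realType} {n : nat} (W : n.-tuple R -> R).
Local Notation mu := (lebesgue_tuple R n).
Implicit Types s t x : n.-tuple R.

Definition cos_transform s : R := \int[mu]_x (W x * cos (2 * pi * dotp s x)).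

Hypothesis W_ge0 : forall x, 0 <= W x.
Hypothesis W_int : mu.-integrable setT (EFin \o W).

Let mW : measurable_fun setT W.
Proof. by apply/measurable_EFinP; exact: measurable_int W_int. Qed.

Lemma measurable_dotp_comp (h : R -> R) s : continuous h ->
  measurable_fun setT (fun x : n.-tuple R => h (2 * pi * dotp s x)).
Proof.
move=> hc; have mh : measurable_fun setT h by exact: continuous_measurable_fun.
have ml : measurable_fun setT (fun x : n.-tuple R => 2 * pi * dotp s x).
  by apply: measurable_funM => //; apply: measurable_dotp.
exact: (measurableT_comp mh ml).
Qed.

Lemma integrable_mul_cos s :
  mu.-integrable setT (EFin \o (fun x => W x * cos (2 * pi * dotp s x))).
Proof.
apply: (integrable_mul_bounded (C := 1) W_int).
  by apply: measurable_dotp_comp; exact: continuous_cos.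
by move=> x; exact: cos_max.
Qed.

(* For [v = 0] the coefficient is [_ / 0 = 0], so this is the identity. *)
Definition reflection (v x : n.-tuple R) : n.-tuple R :=
  addt x (scalet (- (2 * dotp x v / dotp v v)) v).

Lemma measurable_reflection v : measurable_fun setT (reflection v).
Proof.
apply: measurable_addt => //; apply: measurable_scalet => //.
apply: measurableT_comp => //; apply: measurable_funM => //.
by apply: measurable_funM => //; apply: measurable_dotp.
Qed.

Lemma reflectionD v : {morph reflection v : x y / addt x y}.
Proof.
move=> x y; apply: eq_from_tnth => i.
rewrite !(tnth_addt, tnth_scalet) dotpDl; ring.
Qed.

Lemma dotp_reflection v x y :
  dotp (reflection v x) y = dotp x (reflection v y).
Proof.
rewrite dotpDl dotpZl dotpDr dotpZr (dotpC v y) (dotpC x y) (dotpC y x).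
ring.
Qed.

Lemma reflectionK v : involutive (reflection v).
Proof.
move=> x; apply: eq_from_tnth => i.
rewrite !(tnth_addt, tnth_scalet) dotpDl dotpZl.
have [->|v0] := eqVneq (dotp v v) 0; first by rewrite invr0; ring.
by field.
Qed.

Lemma enorm_reflection v x : enorm (reflection v x) = enorm x.
Proof. by rewrite /enorm dotp_reflection reflectionK. Qed.

(** This is the reflection in the hyperplane bisecting s and t: for v = s - t, equal norms give
    <v,v> = 2 <s,v>, so the coefficient of v is -1. If s = t the coefficient is 0, but v
    vanishes. *)
Lemma reflection_swap s t : enorm s = enorm t ->
  reflection (addt s (scalet (-1) t)) s = t.
Proof.
move=> st; set v := addt _ _.
have stE : dotp s s = dotp t t by rewrite -!enorm_sqr st.
have vvE : dotp v v = 2 * dotp s v.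
  rewrite /v !(dotpDl, dotpDr, dotpZl, dotpZr) (dotpC t s) stE; ring.
have sE : addt s (scalet (-1) v) = t.
  apply: eq_from_tnth => i; rewrite !(tnth_addt, tnth_scalet); ring.
rewrite -[RHS]sE /reflection -vvE.
have [v0|v0] := eqVneq (dotp v v) 0; last by rewrite divff.
have nv0 : enorm v = 0 by rewrite /enorm v0 sqrtr0.
by congr addt; rewrite !enorm0_scalet0.
Qed.

Hypothesis W_radial : forall x y, enorm x = enorm y -> W x = W y.

(** Substitute the reflection that takes s to t: it preserves the measure and [W], and being
    self-adjoint it passes from x to the frequency s. *)
Lemma cos_transform_radial s t :
  enorm s = enorm t -> cos_transform s = cos_transform t.
Proof.
move=> /reflection_swap; set v := addt _ _ => Hs.
have [_ /=] := @Rintegral_comp_scaled _ _ _ mu 1 (reflection v)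
  (fun x => W x * cos (2 * pi * dotp s x)) ltr01 (measurable_reflection v)
  (fun g mg g0 => etrans (mul1e _) (ge0_integral_isometry
     (measurable_reflection v) (reflectionD v) (@reflectionK v)
     (enorm_reflection v) mg g0)) (integrable_mul_cos s).
rewrite mul1r /cos_transform => <-; apply: eq_Rintegral => x _.
by rewrite (W_radial (enorm_reflection v x)) -dotp_reflection Hs.
Qed.

Hypothesis W_supp : forall x, 1 <= enorm x -> W x = 0.

Let dotp_supp s x : enorm x < 1 -> `|dotp s x| <= enorm s.
Proof.
move=> x1; rewrite (le_trans (cauchy_schwarz s x))//.
by rewrite ler_piMr ?enorm_ge0// ltW.
Qed.

Lemma cos_transform_ge0 s : enorm s <= 1 / 4 -> 0 <= cos_transform s.
Proof.
move=> s4; apply: Rintegral_ge0 => x _.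
have [x1|x1] := ltP (enorm x) 1; last by rewrite W_supp// mul0r.
rewrite mulr_ge0//; apply: cos_ge0_pihalf; rewrite -ler_norml.
rewrite normrM gtr0_norm; last by rewrite mulr_gt0// pi_gt0.
have := le_trans (dotp_supp s x1) s4; have := pi_gt0 R; nra.
Qed.

(** By radiality s may be taken on the ray of t, as a t with 0 <= a <= 1. On the support of [W] the
    phase y = 2 pi |<t,x>| is at most pi / 2, and cos (a y) >= cos y holds pointwise. *)
Lemma cos_transform_nonincreasing s t :
  enorm s <= enorm t -> enorm t <= 1 / 4 ->
  cos_transform t <= cos_transform s.
Proof.
move=> st t4; have t0 := enorm_ge0 t; have s0 := enorm_ge0 s.
have [te|te] := eqVneq (enorm t) 0.
  rewrite (@cos_transform_radial s t)//.
  by apply/eqP; rewrite eq_le st te s0.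
have t_gt0 : 0 < enorm t by rewrite lt_def te.
pose a := enorm s / enorm t.
have a0 : 0 <= a by rewrite divr_ge0.
have a1 : a <= 1 by rewrite ler_pdivrMr// mul1r.
rewrite (@cos_transform_radial s (scalet a t)); last first.
  by rewrite enormZ ger0_norm// divfK.
clearbody a.
apply: le_Rintegral => //; [exact: integrable_mul_cos..|move=> x _].
have [x1|x1] := ltP (enorm x) 1; last by rewrite W_supp// !mul0r.
rewrite ler_wpM2l// dotpZl.
rewrite -cos_norm -[leRHS]cos_norm.
have := le_trans (dotp_supp t x1) t4; have := pi_gt0 R.
have -> : 2 * pi * (a * dotp t x) = a * (2 * pi * dotp t x) by ring.
rewrite !normrM (ger0_norm a0) (gtr0_norm (pi_gt0 R)) normr_nat.
have := normr_ge0 (dotp t x); move: `|dotp t x| => y y0 p0 y4.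
have b0 : 0 <= 2 * pi * y by rewrite !mulr_ge0// ltW.
have b1 : 2 * pi * y <= pi by nra.
have ab : a * (2 * pi * y) <= 2 * pi * y by rewrite ler_piMl.
have [->//|neq] := eqVneq (a * (2 * pi * y)) (2 * pi * y).
apply: ltW; rewrite ltr_cos ?in_itv/= ?b0 ?b1// ?lt_neqAle ?neq//.
by rewrite mulr_ge0// (le_trans ab b1).
Qed.

End cosine_transform.

(** * Separation of |M| from its value at the origin *)

Section cosine_transform_gap.
Context {R : realType} {n : nat} (W : n.-tuple R -> R) (c : R).
Local Notation mu := (lebesgue_tuple R n).
Implicit Types s t x : n.-tuple R.
Hypothesis n_gt0 : (0 < n)%N.
Hypothesis W_ge0 : forall x, 0 <= W x.
Hypothesis W_int : mu.-integrable setT (EFin \o W).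
Hypothesis W_radial : forall x y, enorm x = enorm y -> W x = W y.
Hypothesis W_supp : forall x, 1 <= enorm x -> W x = 0.
Hypothesis c_gt0 : 0 < c.
Hypothesis W_lb : forall x, enorm x < 1 / 2 -> c <= W x.

Let I := \int[mu]_x W x.
Let M := cos_transform W.
(** [W] is at least c on the ball of radius 1/2, which contains the ball of radius 1/4 together with
    its translates by vectors of norm at most 1/4. *)
Let delta := c * fine (mu (eball (1 / 4))).

Lemma integrable_mul_affine_cos (a : R) s : mu.-integrable setT
  (EFin \o (fun x => W x * (1 + a * cos (2 * pi * dotp s x)))).
Proof.
apply: (integrable_mul_bounded (C := 1 + `|a|) W_int).
  apply: measurable_funD => //; apply: measurable_funM => //.
  by apply: measurable_dotp_comp; exact: continuous_cos.
move=> x; rewrite (le_trans (ler_normD _ _))// normr1 lerD2l normrM.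
by rewrite ler_piMr// cos_max.
Qed.

(** With a = -1 and a = 1 this gives I - M s and I + M s, so that pointwise inequalities between 1 -
    cos and 1 + cos become inequalities between values of M. *)
Lemma Rintegral_mul_affine_cos (a : R) s :
  \int[mu]_x (W x * (1 + a * cos (2 * pi * dotp s x))) = I + a * M s.
Proof.
have icos := integrable_mul_cos W_int s.
rewrite /I /M /cos_transform -RintegralZl// -RintegralD//; last first.
  exact: (integrableZl measurableT a icos).
by apply: eq_Rintegral => x _; ring.
Qed.

Let measure_quarter : exists2 v, 0 < v & mu (eball (1 / 4)) = v%:E.
Proof.
have := eball1_measure_lty (R := R) (n := n).
have := eball1_measure_gt0 (R := R) (n := n).
rewrite (measure_eball (r := 1 / 4))//.
case: (mu (eball 1)) => [v| |]//; rewrite lte_fin => v0 _.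
by exists ((1 / 4) ^+ n * v) => //; rewrite mulr_gt0 ?exprn_gt0.
Qed.

Let delta_gt0 : 0 < delta.
Proof.
by rewrite /delta; have [v v0 ->] := measure_quarter; rewrite mulr_gt0.
Qed.

(* Translating by [v = s / (2 |s|^2)] changes the sign of the cosine, so the
   values of [1 - cos] at [x] and [x + v] add up to [2]. *)
Lemma cos_gap_far s : 2 <= enorm s -> delta <= I - M s.
Proof.
move=> s2.
pose g x := 1 + -1 * cos (2 * pi * dotp s x).
have g0 x : 0 <= g x by rewrite /g mulN1r subr_ge0 cos_le1.
pose h x := (W x * g x)%:E.
have h0 x : (0 <= h x)%E by rewrite lee_fin mulr_ge0.
have inth : (\int[mu]_x h x = (I - M s)%:E)%E.
  rewrite -[in RHS](mulN1r (M s)) -Rintegral_mul_affine_cos /Rintegral fineK//.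
  exact: (integrable_fin_num measurableT (integrable_mul_affine_cos (-1) s)).
have mh : measurable_fun setT h.
  exact: measurable_int (integrable_mul_affine_cos (-1) s).
have ss : dotp s s != 0 by rewrite -enorm_sqr expf_neq0// gt_eqF//; lra.
pose v := scalet (2 * dotp s s)^-1 s.
have gv x : g (addt x v) = 2 - g x.
  rewrite /g dotpDr dotpZr.
  have -> : 2 * pi * (dotp s x + (2 * dotp s s)^-1 * dotp s s) =
    2 * pi * dotp s x + pi :> R by field.
  by rewrite cosDpi; ring.
(* |v| = 1 / (2 |s|), which is where |s| >= 2 enters. *)
have nv : enorm v <= 1 / 4.
  have s4 : 0 < 2 * enorm s ^+ 2 by nra.
  rewrite enormZ -enorm_sqr ger0_norm ?invr_ge0 ?(ltW s4)//.
  by rewrite ler_pdivrMl//; nra.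
have mB : measurable (eball (1 / 4) : set (n.-tuple R)).
  exact: measurable_eball.
have hv : (\int[mu]_x h (addt x v) = (I - M s)%:E)%E.
  by rewrite -inth; exact: ge0_integral_addt.
have mhv : measurable_fun setT (fun x => h (addt x v)).
  by apply: (measurableT_comp mh); exact: measurable_addt.
have : (\int[mu]_x ((2 * c)%:E * (\1_(eball (1 / 4)) x)%:E) <=
    \int[mu]_x (h x + h (addt x v)))%E.
  apply: ge0_le_integral => //=.
  - by move=> x _; rewrite -EFinM lee_fin !mulr_ge0// ltW.
  - apply: emeasurable_funM => //; apply/measurable_EFinP.
    exact: measurable_indic.
  - exact: emeasurable_funD.
  move=> x _; rewrite -EFinM -EFinD lee_fin indicE in_eball.
  have [x4|_] := ltP (enorm x) (1 / 4); last first.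
    by rewrite mulr0 addr_ge0// mulr_ge0.
  have w1 : c <= W x by apply: W_lb; lra.
  have w2 : c <= W (addt x v).
    by apply: W_lb; apply: (le_lt_trans (ler_enormD _ _)); move: nv; lra.
  rewrite mulr1 (_ : 2 * c = c * g x + c * g (addt x v)); last first.
    by rewrite gv; ring.
  by rewrite lerD// ler_wpM2r.
have mI : measurable_fun setT (fun x => (\1_(eball (1 / 4)) x : R)%:E).
  by apply/measurable_EFinP; exact: measurable_indic.
have cc0 : (0 <= (2 * c)%:E)%E by rewrite lee_fin mulr_ge0// ltW.
have -> : (\int[mu]_x ((2 * c)%:E * (\1_(eball (1 / 4)) x)%:E) =
    (2 * c)%:E * mu (eball (1 / 4)))%E.
  by rewrite ge0_integralZl// integral_indic// setIT.
rewrite ge0_integralD// inth hv /delta.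
have [w w0 ->] := measure_quarter.
by rewrite -EFinM -EFinD lee_fin /=; lra.
Qed.

Let le_gap (a b k : R) s t :
  (forall x, 1 + a * cos (2 * pi * dotp s x) <=
    k * (1 + b * cos (2 * pi * dotp t x))) ->
  I + a * M s <= k * (I + b * M t).
Proof.
move=> H; rewrite -!Rintegral_mul_affine_cos -RintegralZl//; last first.
  exact: integrable_mul_affine_cos.
apply: le_Rintegral => //; first exact: integrable_mul_affine_cos.
  by have := integrableZl measurableT k (integrable_mul_affine_cos b t).
by move=> x _; rewrite mulrCA ler_wpM2l.
Qed.

Let cos_double x s :
  cos (2 * pi * dotp (scalet 2 s) x) = 2 * cos (2 * pi * dotp s x) ^+ 2 - 1.
Proof.
rewrite dotpZl (_ : 2 * pi * (2 * _) = (2 * pi * dotp s x) *+ 2); last first.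
  by rewrite -mulr_natl; ring.
by rewrite cos_mulr2n -mulr_natl.
Qed.

(* Iterates [1 - cos (2 y) <= 4 (1 - cos y)]. *)
Lemma cos_gap_dyadic k s : 2 <= 2 ^+ k * enorm s -> delta <= 4 ^+ k * (I - M s).
Proof.
elim: k s => [|k IHk] s; first by rewrite !expr0 !mul1r; exact: cos_gap_far.
rewrite !exprS => h; have := IHk (scalet 2 s).
rewrite enormZ normr_nat mulrCA mulrA => /(_ h) /le_trans; apply.
rewrite (mulrC 4) -mulrA ler_wpM2l ?exprn_ge0//.
rewrite -!(mulN1r (M _)); apply: le_gap => // x.
rewrite cos_double; have := cos_le1 (2 * pi * dotp s x).
have := cos_geN1 (2 * pi * dotp s x); nra.
Qed.

(** The bound on -M s passes through the frequency 2 s: a gap of I - M at 2 s yields one of I + M at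
    s, at the cost of a factor 4. As 2^5 |s| and 2^4 |2 s| are at least 4, the constant 4^5 serves
    both signs. *)
Lemma cos_gap_upper s : 1 / 8 <= enorm s -> `|M s| <= I - delta / 4 ^+ 5.
Proof.
move=> s8.
have p : (0 : R) < 4 ^+ 5 by rewrite exprn_gt0.
have E5 : (2 : R) ^+ 5 = 32 by rewrite -natrX.
have E4 : (2 : R) ^+ 4 = 16 by rewrite -natrX.
rewrite ler_norml; apply/andP; split; last first.
  have : delta <= 4 ^+ 5 * (I - M s) by apply: cos_gap_dyadic; lra.
  by rewrite -ler_pdivrMl// mulrC; lra.
have h1 : delta <= 4 ^+ 4 * (I - M (scalet 2 s)).
  by apply: cos_gap_dyadic; rewrite enormZ normr_nat; lra.
(* [1 - cos (2 y) <= 4 (1 + cos y)] *)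
have h2 : I - M (scalet 2 s) <= 4 * (I + 1 * M s).
  rewrite -!(mulN1r (M _)); apply: le_gap => // x.
  rewrite cos_double; have := cos_le1 (2 * pi * dotp s x).
  have := cos_geN1 (2 * pi * dotp s x); nra.
have : delta / 4 ^+ 5 <= I + M s.
  rewrite ler_pdivrMr//; apply: (le_trans h1).
  rewrite mul1r in h2; rewrite [in leRHS]exprS mulrCA mulrC.
  by rewrite [leRHS]mulrA ler_wpM2r// exprn_ge0.
lra.
Qed.

(** The support of [W] lies in the unit ball, where the phase is uniformly small with s; continuity
    of cos at 0 then suffices. *)
Lemma cos_transform_near0 (e : R) : 0 < e ->
  exists2 r, 0 < r & forall s, enorm s <= r -> I - e <= M s.
Proof.
move=> e0.
have I0 : 0 <= I by rewrite /I; apply: Rintegral_ge0 => x _; exact: W_ge0.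
(* The summand 1 keeps the denominator positive even if I = 0. *)
pose e' := e / (I + 1).
have e'0 : 0 < e' by rewrite divr_gt0//; lra.
have /cvgrPdist_le/(_ _ e'0) := @continuous_cos R 0.
rewrite cos0 => cos1.
have [r r0 hr] : exists2 r : R, 0 < r &
    forall y, `|y| < r -> `|1 - cos y| <= e'.
  have /nbhs_ballP[r r0 hr] := cos1; exists r => // y yr.
  by apply: hr; rewrite /ball/= sub0r normrN.
(* This bounds the phase by r / 2, strictly below r. *)
exists (r / (4 * pi)); first by rewrite divr_gt0// mulr_gt0// pi_gt0.
move=> s sr.
suff : I - M s <= e' * I.
  have : e' * I <= e by rewrite /e' mulrAC ler_pdivrMr; nra.
  lra.
rewrite -(mulN1r (M s)) -Rintegral_mul_affine_cos -RintegralZl//.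
apply: le_Rintegral => //; first exact: integrable_mul_affine_cos.
  by have := integrableZl measurableT e' W_int.
move=> x _; rewrite (mulrC e').
have [x1|x1] := ltP (enorm x) 1; last by rewrite W_supp// !mul0r.
apply: ler_wpM2l => //; rewrite mulN1r.
apply: (le_trans (ler_norm _)); apply: hr.
rewrite !normrM normr_nat (gtr0_norm (pi_gt0 R)).
have p0 := pi_gt0 R.
have d1 : `|dotp s x| <= r / (4 * pi).
  rewrite (le_trans (cauchy_schwarz s x))// (le_trans _ sr)//.
  by rewrite ler_piMr ?enorm_ge0// ltW.
apply: (@le_lt_trans _ _ (r / 2)); last lra.
have -> : r / 2 = 2 * pi * (r / (4 * pi)).
  by move: p0; generalize (pi : R) => p p0; field; rewrite gt_eqF.
by rewrite ler_wpM2l// mulr_ge0// ltW.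
Qed.

(** The tolerance near 0 equals the gap for |t| >= 1/8, which settles such t. Otherwise both norms
    are below 1/4, where M is nonnegative and decreasing. *)
Lemma cos_transform_peak : exists2 r, 0 < r &
  forall s t, enorm s <= r -> enorm s <= enorm t -> `|M t| <= M s.
Proof.
have d0 : 0 < delta / 4 ^+ 5 by rewrite divr_gt0 ?exprn_gt0.
have [r r0 hr] := cos_transform_near0 d0.
exists (Num.min r (1 / 8)); first by rewrite lt_min r0/=; lra.
move=> s t; rewrite le_min => /andP[sr s8] st.
have [t8|t8] := leP (1 / 8) (enorm t).
  exact: (le_trans (cos_gap_upper t8) (hr _ sr)).
rewrite ger0_norm; first by apply: cos_transform_nonincreasing => //; lra.
by apply: cos_transform_ge0 => //; lra.
Qed.

End cosine_transform_gap.

(** * Symmetric decreasing rearrangement *)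

(** Adding the finite quantity c mu(A) = c mu(B) to both sides avoids subtracting integrals that may
    be infinite. *)
Lemma bathtub d (T : measurableType d) (R : realType)
    (mu : {measure set T -> \bar R}) (A B : set T) (k : T -> R) (c : R) :
  measurable A -> measurable B -> mu A = mu B -> (mu B < +oo)%E ->
  measurable_fun setT k -> (forall x, 0 <= k x) -> 0 <= c ->
  (forall x, x \in B -> c <= k x) -> (forall x, x \notin B -> k x <= c) ->
  (\int[mu]_x ((\1_A x)%:E * (k x)%:E) <=
   \int[mu]_x ((\1_B x)%:E * (k x)%:E))%E.
Proof.
move=> mA mB AB Boo mk k0 c0 kB kC.
have mI (C : set T) : measurable C ->
    measurable_fun setT (fun x => (\1_C x : R)%:E).
  by move=> mC; apply/measurable_EFinP; exact: measurable_indic.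
have mkE : measurable_fun setT (EFin \o k) by apply/measurable_EFinP.
have mIk (C : set T) : measurable C ->
    measurable_fun setT (fun x => (\1_C x : R)%:E * (k x)%:E)%E.
  by move=> mC; apply: emeasurable_funM => //; exact: mI.
have mIc (C : set T) : measurable C ->
    measurable_fun setT (fun x => c%:E * (\1_C x : R)%:E)%E.
  by move=> mC; apply: emeasurable_funM => //; exact: mI.
have Ik0 (C : set T) x : (0 <= (\1_C x : R)%:E * (k x)%:E)%E.
  by rewrite mule_ge0// lee_fin.
have Ic0 (C : set T) x : (0 <= c%:E * (\1_C x : R)%:E)%E.
  by rewrite mule_ge0// lee_fin.
have intc (C : set T) : measurable C ->
    (\int[mu]_x (c%:E * (\1_C x : R)%:E) = c%:E * mu C)%E.
  move=> mC; rewrite ge0_integralZl//; last exact: mI.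
  by rewrite integral_indic// setIT.
have cB : (c%:E * mu B)%E \is a fin_num.
  by rewrite fin_numM// ge0_fin_numE.
rewrite -(leeD2rE _ _ cB) -{1}(intc _ mB) -AB -(intc _ mA).
rewrite -!ge0_integralD//; [|exact: mIk|exact: mIc|exact: mIk|exact: mIc].
(* Pointwise, [1_A k + c 1_B <= 1_B k + c 1_A]. *)
apply: ge0_le_integral => //.
- by move=> x _; rewrite adde_ge0.
- by apply: emeasurable_funD; [exact: mIk|exact: mIc].
- by apply: emeasurable_funD; [exact: mIk|exact: mIc].
move=> x _; rewrite -!EFinM -!EFinD lee_fin !indicE.
have := kB x; have := kC x; case: (x \in B); case: (x \in A) => /=.
- lra.
- by move=> _ /(_ isT); lra.
- by move=> /(_ isT) + _; lra.
- lra.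
Qed.

Section symmetric_rearrangement.
Context {R : realType} {n : nat} (a : n.-tuple R -> R).
Local Notation mu := (lebesgue_tuple R n).
Local Notation leb := (@lebesgue_measure R).
Let RM := measurableTypeR R.
Hypothesis n_gt0 : (0 < n)%N.
Hypothesis ma : measurable_fun setT a.
Hypothesis a_supp : (mu [set y | (0 < a y)%R] < +oo)%E.

Let level (l : RM) : set (n.-tuple R) := [set y | l < a y].
Let V : R := fine (mu (eball 1)).

(** The radius that [symm_set] selects by [xget], made explicit so that its measurability in the
    level can be proved. *)
Definition ball_radius (E : set (n.-tuple R)) : R :=
  (fine (mu E) / V) `^ n%:R^-1.

Let VE : mu (eball 1) = V%:E.
Proof.
by rewrite fineK// ge0_fin_numE// eball1_measure_lty.
Qed.

Let V_gt0 : 0 < V.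
Proof. by rewrite -lte_fin -VE eball1_measure_gt0. Qed.

Lemma measure_ball_radius (E : set (n.-tuple R)) : (mu E < +oo)%E ->
  mu (eball (ball_radius E)) = mu E.
Proof.
move=> Eoo; rewrite measure_eball ?powR_ge0// VE -powR_mulrn ?powR_ge0//.
rewrite -powRrM mulVf ?pnatr_eq0 -?lt0n// powRr1; last first.
  by rewrite divr_ge0 ?fine_ge0// ltW.
by rewrite -EFinM divfK ?gt_eqF// fineK// ge0_fin_numE.
Qed.

Lemma symm_setE (E : set (n.-tuple R)) : (mu E < +oo)%E ->
  symm_set E = eball (ball_radius E).
Proof.
move=> Eoo; congr eball; apply: xget_unique.
  by split; [exact: powR_ge0|exact: measure_ball_radius].
move=> r [r0]; rewrite -(measure_ball_radius Eoo).
rewrite (measure_eball r0)// (measure_eball (r := ball_radius E)) ?powR_ge0//.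
rewrite VE -!EFinM => -[].
move=> /(mulIf (lt0r_neq0 V_gt0)) /eqP.
by rewrite eqrXn2 ?powR_ge0// => /eqP.
Qed.

Let measurable_level l : measurable (level l).
Proof.
rewrite -[level l]setTI.
have : measurable_fun setT (fun y => l < a y) by exact: measurable_fun_ltr.
by move=> /(_ measurableT [set true]); apply.
Qed.

Let level_lty l : 0 < l -> (mu (level l) < +oo)%E.
Proof.
move=> l0; apply: le_lt_trans a_supp.
by apply: le_measure; rewrite ?inE;
  [exact: measurable_level|exact: measurable_level|move=> y; exact: lt_trans].
Qed.

(** For [a] the modulus of phi this is convertible to [symm_rearr phi]; the theory only needs the
    real function [a]. *)
Definition rearrangement x : R :=
  \int[leb]_(l in `]0, +oo[) \1_(symm_set [set y | l < a y]) x.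

(* [Q1] and [Q2] are the regions under the graphs of [a] and of its
   rearrangement; both are integrated with Tonelli's theorem. *)
Let Q1 : set (RM * n.-tuple R) := [set p | 0 < p.1 /\ p.1 < a p.2].

Let mQ1 : measurable Q1.
Proof.
have h1 : measurable_fun setT (fun p : RM * n.-tuple R => 0 < p.1).
  by apply: measurable_fun_ltr => //; exact: measurable_fst.
have h2 : measurable_fun setT (fun p : RM * n.-tuple R => p.1 < a p.2).
  apply: measurable_fun_ltr; first exact: measurable_fst.
  exact: (measurableT_comp ma).
have := measurableI _ _ (h1 measurableT [set true] I)
  (h2 measurableT [set true] I).
by rewrite !setTI.
Qed.

Let section1 l : 0 < l -> xsection Q1 l = level l.
Proof.
move=> l0; apply/seteqP; split=> x; rewrite /xsection /level/= inE /Q1/=.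
  by case.
by [].
Qed.

(** Taken from the section of [Q1] and not from [level l], so that measurability in l is that of the
    measure of sections; for l > 0 both sets agree. *)
Let rad (l : RM) : R := ball_radius (xsection Q1 l).

Let mrad : measurable_fun setT rad.
Proof.
apply: (measurableT_comp (@measurable_powR R _)).
apply: measurable_funM => //.
apply: (measurableT_comp (fine_measurable measurableT)).
exact: (measurable_fun_xsection mu mQ1).
Qed.

Let Q2 : set (RM * n.-tuple R) := [set p | 0 < p.1 /\ enorm p.2 < rad p.1].

Let mQ2 : measurable Q2.
Proof.
have h1 : measurable_fun setT (fun p : RM * n.-tuple R => 0 < p.1).
  by apply: measurable_fun_ltr => //; exact: measurable_fst.
have h2 : measurable_fun setT (fun p : RM * n.-tuple R => enorm p.2 < rad p.1).
  apply: measurable_fun_ltr; first by apply: measurable_enorm.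
  exact: (measurableT_comp mrad).
have := measurableI _ _ (h1 measurableT [set true] I)
  (h2 measurableT [set true] I).
by rewrite !setTI.
Qed.

(** The rearrangement before [fine]: it may be +oo where the real-valued integral defaults to 0.
    Tonelli applies to [star], and the two functions agree almost everywhere once [star] is
    integrable. *)
Let star (x : n.-tuple R) : \bar R := (\int[leb]_l (\1_Q2 (l, x))%:E)%E.

Let star_ge0 x : (0 <= star x)%E.
Proof. by apply: integral_ge0 => l _; rewrite lee_fin. Qed.

Let mindicQ (Q : set (RM * n.-tuple R)) : measurable Q ->
  measurable_fun setT (fun p => (\1_Q p : R)%:E).
Proof. by move=> mQ; apply/measurable_EFinP; exact: measurable_indic. Qed.

Let mstar : measurable_fun setT star.
Proof.
apply: (measurable_fun_fubini_tonelli_G (fun p => (\1_Q2 p : R)%:E)) => //.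
exact: mindicQ.
Qed.

Let tonelliQ (Q : set (RM * n.-tuple R)) (g : n.-tuple R -> R) :
  measurable Q -> measurable_fun setT g -> (forall x, 0 <= g x) ->
  (\int[mu]_x ((\int[leb]_l (\1_Q (l, x))%:E) * (g x)%:E) =
   \int[leb]_l \int[mu]_x ((\1_Q (l, x))%:E * (g x)%:E))%E.
Proof.
move=> mQ mg g0.
have mf : measurable_fun setT
    (fun p : RM * n.-tuple R => (\1_Q p : R)%:E * (g p.2)%:E)%E.
  apply: emeasurable_funM; first exact: mindicQ.
  by apply/measurable_EFinP; exact: (measurableT_comp mg).
rewrite (fubini_tonelli (fun p : RM * n.-tuple R =>
  (\1_Q p : R)%:E * (g p.2)%:E)%E)//; last first.
  by move=> p; rewrite mule_ge0// lee_fin.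
apply: eq_integral => x _.
rewrite -ge0_integralZr ?lee_fin//.
by apply: (measurableT_comp (mindicQ mQ)); exact: measurable_fun_pair.
Qed.

Let rearrangementE x : rearrangement x = fine (star x).
Proof.
rewrite /rearrangement /Rintegral integral_mkcond; congr fine.
apply: eq_integral => l _; rewrite patchE.
case: ifPn => [|/negP l0].
  rewrite inE/= in_itv/= andbT => l0.
  have loo := level_lty l0.
  rewrite -/(level l) symm_setE// !indicE in_eball; congr (_%:R%:E).
  congr nat_of_bool; apply/idP/idP; rewrite inE/Q2/= /rad section1//.
  by case.
rewrite indicE memNset// => -[/= l_gt0 _]; apply: l0.
by rewrite inE/= in_itv/= l_gt0.
Qed.

Hypothesis a_ge0 : forall x, 0 <= a x.

Let layer_cake x : (\int[leb]_l (\1_Q1 (l, x))%:E = (a x)%:E)%E.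
Proof.
transitivity (\int[leb]_l (\1_(`]0%R, a x[%classic : set RM) l)%:E)%E.
  apply: eq_integral => l _; rewrite !indicE.
  congr (_%:R%:E); congr nat_of_bool.
  apply/idP/idP; rewrite !inE/= in_itv/= /Q1/=; first by move=> [-> ->].
  by move=> /andP[].
rewrite integral_indic//= setIT.
change (leb `]0, a x[%classic = (a x)%:E).
rewrite lebesgue_measure_itv/= lte_fin; case: ifPn => [_|].
  by rewrite sube0.
by rewrite -leNgt => ax; congr EFin; apply/eqP; rewrite eq_le ax a_ge0.
Qed.

Let level_measureE (l : RM) : 0 < l ->
  mu (xsection Q1 l) = mu (xsection Q2 l).
Proof.
move=> l0; rewrite (_ : xsection Q2 l = eball (rad l)).
  by rewrite measure_ball_radius// section1//; exact: level_lty.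
apply/seteqP; split=> x; rewrite /xsection /= inE /Q2/=.
  by case.
by [].
Qed.

Let section_le0 (Q : set (RM * n.-tuple R)) (l : RM) (g : n.-tuple R -> R) :
  (forall p, Q p -> 0 < p.1) -> l <= 0 ->
  (\int[mu]_x ((\1_Q (l, x))%:E * (g x)%:E) = 0)%E.
Proof.
move=> Q0 l0; apply: integral0_eq => x _.
by rewrite indicE memNset ?mul0e// => /Q0/=; rewrite ltNge l0.
Qed.

Let indic_xsection (Q : set (RM * n.-tuple R)) l x :
  \1_Q (l, x) = \1_(xsection Q l) x :> R.
Proof. by rewrite !indicE mem_xsection. Qed.

(** [Q1] and [Q2] have sections of equal measure at every level. This makes [star] integrable, hence
    finite almost everywhere. *)
Let integral_star : (\int[mu]_x star x = \int[mu]_x (a x)%:E)%E.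
Proof.
have t Q : measurable Q -> (\int[mu]_x \int[leb]_l (\1_Q (l, x))%:E =
    \int[leb]_l \int[mu]_x ((\1_Q (l, x))%:E * 1%:E))%E.
  move=> mQ; rewrite -(tonelliQ mQ (g := cst 1))//.
  by apply: eq_integral => x _; rewrite mule1.
transitivity (\int[mu]_x \int[leb]_l (\1_Q1 (l, x))%:E)%E; last first.
  by apply: eq_integral => x _; rewrite layer_cake.
rewrite (t _ mQ1) (t _ mQ2); apply: eq_integral => l _.
have [l0|l0] := ltP 0 l; last by rewrite !(@section_le0 _ _ (cst 1))// => p [].
have t1 Q : measurable Q -> (\int[mu]_x ((\1_Q (l, x))%:E * 1%:E) =
    mu (xsection Q l))%E.
  move=> mQ; transitivity (\int[mu]_x (\1_(xsection Q l) x : R)%:E)%E.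
    by apply: eq_integral => x _; rewrite mule1 indic_xsection.
  by rewrite integral_indic ?setIT//; exact: measurable_xsection.
by rewrite !t1//; exact/esym/level_measureE.
Qed.

Hypothesis a_int : mu.-integrable setT (EFin \o a).

Let integrable_star : mu.-integrable setT star.
Proof.
apply/integrableP; split => //.
under eq_integral do rewrite gee0_abs//.
by rewrite integral_star; exact: integrable_lty a_int.
Qed.

Let star_ae : {ae mu, forall x, star x = (rearrangement x)%:E}.
Proof.
apply: filterS (integrable_ae measurableT integrable_star) => x /(_ I) h.
by rewrite rearrangementE fineK.
Qed.

Lemma rearrangement_ge0 x : 0 <= rearrangement x.
Proof. by rewrite rearrangementE fine_ge0. Qed.

Lemma measurable_rearrangement : measurable_fun setT rearrangement.
Proof.
rewrite (_ : rearrangement = fine \o star); last first.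
  by apply/funext => x; rewrite rearrangementE.
exact: (measurableT_comp (fine_measurable measurableT)).
Qed.

Lemma integrable_rearrangement :
  mu.-integrable setT (EFin \o rearrangement).
Proof.
have mr : measurable_fun setT (EFin \o rearrangement).
  by apply/measurable_EFinP; exact: measurable_rearrangement.
apply/integrableP; split => //.
under eq_integral do rewrite gee0_abs ?lee_fin ?rearrangement_ge0//.
rewrite (@ge0_ae_eq_integral _ _ _ mu setT (EFin \o rearrangement) star)//.
- exact: integrable_lty integrable_star.
- by move=> x _; rewrite lee_fin rearrangement_ge0.
- by apply: filterS star_ae => x + _.
Qed.

Let rad_le l : 0 < l -> rad l <= ball_radius [set y | 0 < a y].
Proof.
move=> l0; rewrite /rad /ball_radius section1//.
apply: ge0_ler_powR;
  rewrite ?invr_ge0 ?nnegrE ?divr_ge0 ?fine_ge0 ?(ltW V_gt0)//.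
rewrite ler_pM2r ?invr_gt0//; apply: fine_le.
- by rewrite ge0_fin_numE// level_lty.
- by rewrite ge0_fin_numE.
by apply: le_measure; rewrite ?inE;
  [exact: measurable_level|exact: measurable_level|move=> y; exact: lt_trans].
Qed.

Lemma rearrangement_outside x : ball_radius [set y | 0 < a y] <= enorm x ->
  rearrangement x = 0.
Proof.
move=> rx; rewrite rearrangementE [star x]integral0_eq// => l _.
rewrite indicE memNset// => -[/= l0]; apply/negP; rewrite -leNgt.
by rewrite (le_trans (rad_le l0)).
Qed.

(** The condition on g makes it radially nonincreasing up to radius r and only asks that its values
    farther out stay below; this leaves room for the oscillating tail of |M|. *)
Lemma rearrangement_inequality r (g : n.-tuple R -> R) :
  measurable_fun setT g -> (forall x, 0 <= g x) ->
  (forall x y, enorm x <= r -> enorm x <= enorm y -> g y <= g x) ->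
  ball_radius [set y | 0 < a y] <= r ->
  (\int[mu]_x ((a x)%:E * (g x)%:E) <=
   \int[mu]_x ((rearrangement x)%:E * (g x)%:E))%E.
Proof.
move=> mg g0 gr rr.
have mgE : measurable_fun setT (EFin \o g) by apply/measurable_EFinP.
have -> : (\int[mu]_x ((rearrangement x)%:E * (g x)%:E) =
    \int[mu]_x (star x * (g x)%:E))%E.
  apply: ge0_ae_eq_integral => //.
  - apply: emeasurable_funM => //; apply/measurable_EFinP.
    exact: measurable_rearrangement.
  - exact: emeasurable_funM.
  - by move=> x _; rewrite mule_ge0// lee_fin// rearrangement_ge0.
  - by move=> x _; rewrite mule_ge0// lee_fin.
  - by apply: filterS star_ae => x /= -> _.
have -> : (\int[mu]_x ((a x)%:E * (g x)%:E) =
    \int[mu]_x ((\int[leb]_l (\1_Q1 (l, x))%:E) * (g x)%:E))%E.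
  by apply: eq_integral => x _; rewrite layer_cake.
rewrite (tonelliQ mQ1 mg g0) (tonelliQ mQ2 mg g0).
have mt (Q : set (RM * n.-tuple R)) : measurable Q ->
    measurable_fun setT
      (fun l : RM => \int[mu]_x ((\1_Q (l, x))%:E * (g x)%:E))%E.
  move=> mQ; apply: (measurable_fun_fubini_tonelli_F
    (fun p : RM * n.-tuple R => (\1_Q p : R)%:E * (g p.2)%:E)%E) => //.
    apply: emeasurable_funM; first exact: mindicQ.
    by apply/measurable_EFinP; exact: (measurableT_comp mg).
  by move=> p; rewrite mule_ge0// lee_fin.
apply: ge0_le_integral => //.
- by move=> l _; apply: integral_ge0 => x _; rewrite mule_ge0// lee_fin.
- exact: mt.
- exact: mt.
move=> l _; have [l0|l0] := ltP 0 l; last by rewrite !section_le0// => p [].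
under eq_integral do rewrite indic_xsection.
under [leRHS]eq_integral do rewrite indic_xsection.
have n0 : (0 : R) < Num.sqrt n%:R by rewrite sqrtr_gt0 ltr0n.
(* A point of the sphere of radius [rad l], along the diagonal vector of norm sqrt n; g e is the
   threshold of the bathtub principle. *)
pose e : n.-tuple R := scalet (rad l / Num.sqrt n%:R) [tuple 1 | i < n].
have eE : enorm e = rad l.
  rewrite enormZ ger0_norm ?divr_ge0 ?powR_ge0 ?(ltW n0)//.
  rewrite (_ : enorm _ = Num.sqrt n%:R) ?divfK ?gt_eqF//.
  congr Num.sqrt; rewrite /dotp.
  under eq_bigr do rewrite tnth_mktuple mulr1.
  by rewrite sumr_const card_ord.
have er : enorm e <= r by rewrite eE (le_trans (rad_le l0)).
have inQ2 x : (x \in xsection Q2 l) = (enorm x < rad l).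
  rewrite mem_xsection; apply/idP/idP; rewrite inE/Q2/=; first by case.
  by [].
have Q2oo : (mu (xsection Q2 l) < +oo)%E.
  by rewrite -level_measureE// section1// level_lty.
apply: (@bathtub _ _ _ _ _ _ _ (g e)) => //.
- exact: measurable_xsection.
- exact: measurable_xsection.
- exact: level_measureE.
- move=> x; rewrite inQ2 => xl; apply: gr; rewrite ?eE ?(ltW xl)//.
  by rewrite (le_trans (ltW xl))// -eE.
- by move=> x; rewrite inQ2 -leNgt => lx; apply: gr; rewrite // eE.
Qed.

End symmetric_rearrangement.

(** * Pairing with the Fourier transform *)

Section bounded_kernel.
Context d1 d2 (T1 : measurableType d1) (T2 : measurableType d2) (R : realType).
Variable m1 : {sigma_finite_measure set T1 -> \bar R}.
Variable m2 : {sigma_finite_measure set T2 -> \bar R}.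
Variables (w : T1 -> R) (f : T2 -> R) (k : T1 -> T2 -> R).
Hypothesis w_int : m1.-integrable setT (EFin \o w).
Hypothesis f_int : m2.-integrable setT (EFin \o f).
Hypothesis mk : measurable_fun setT (fun p => k p.1 p.2).
Hypothesis k_le1 : forall x y, `|k x y| <= 1.

Let F (p : T1 * T2) : \bar R := (w p.1 * (f p.2 * k p.1 p.2))%:E.

Let mw : measurable_fun setT w.
Proof. by apply/measurable_EFinP; exact: measurable_int w_int. Qed.

Let mf : measurable_fun setT f.
Proof. by apply/measurable_EFinP; exact: measurable_int f_int. Qed.

(** The bound |k| <= 1 dominates the integrand by |w| |f|, whose double integral factors. *)
Let integrable_F : (m1 \x m2)%E.-integrable setT F.
Proof.
have mF : measurable_fun setT F.
  apply/measurable_EFinP; apply: measurable_funM.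
    exact: (measurableT_comp mw).
  by apply: measurable_funM => //; exact: (measurableT_comp mf).
apply/integrable12ltyP => //.
have [_ wi] := integrableP _ _ _ w_int.
have [_ fi] := integrableP _ _ _ f_int.
have mabsf : measurable_fun setT (fun y => `|(f y)%:E|%E).
  by apply: measurableT_comp => //; exact/measurable_EFinP.
have mabsw : measurable_fun setT (fun x => `|(w x)%:E|%E).
  by apply: measurableT_comp => //; exact/measurable_EFinP.
apply: (@le_lt_trans _ _ (\int[m1]_x \int[m2]_y (`|(w x)%:E| * `|(f y)%:E|))%E).
  apply: ge0_le_integral => //.
  - by move=> x _; exact: integral_ge0.
  - apply: (measurable_fun_fubini_tonelli_F (abse \o F)) => /=.
      exact: measurableT_comp.
    by move=> x; rewrite lee_fin.
  - apply: (measurable_fun_fubini_tonelli_F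
      (fun p : T1 * T2 => `|(w p.1)%:E| * `|(f p.2)%:E|)%E) => //.
    apply: emeasurable_funM; first exact: (measurableT_comp mabsw).
    exact: (measurableT_comp mabsf).
  move=> x _; apply: ge0_le_integral => //.
  - apply: measurableT_comp => //; apply: (measurableT_comp mF).
    exact: measurable_fun_pair.
  - by apply: emeasurable_funM.
  move=> y _; rewrite /F/= -!EFinM lee_fin !normrM ler_wpM2l//.
  by rewrite ler_piMr.
under eq_integral do rewrite ge0_integralZl//.
rewrite ge0_integralZr//; last exact: integral_ge0.
by rewrite lte_mul_pinfty// ?integral_ge0// ge0_fin_numE// integral_ge0.
Qed.

Let innerE x :
  (\int[m2]_y F (x, y) = (w x * (\int[m2]_y (f y * k x y)))%:E)%E.
Proof.
have ifk : m2.-integrable setT (EFin \o (fun y => f y * k x y)).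
  apply: (integrable_mul_bounded f_int (C := 1)) => //.
  have mx : measurable_fun setT (fun y : T2 => (x, y)).
    exact: measurable_fun_pair.
  exact: (measurableT_comp mk mx).
rewrite EFinM /Rintegral fineK ?integrable_fin_num//.
by rewrite -integralZl//.
Qed.

Lemma integrable_bounded_kernel :
  m1.-integrable setT (EFin \o (fun x => w x * (\int[m2]_y (f y * k x y)))).
Proof.
apply: eq_integrable (integrable_fubini_F integrable_F) => // x _.
by rewrite /fubini_F innerE.
Qed.

Lemma bounded_kernel_swap :
  \int[m1]_x (w x * (\int[m2]_y (f y * k x y))) =
  \int[m2]_y (f y * (\int[m1]_x (w x * k x y))).
Proof.
rewrite /Rintegral; congr fine.
transitivity (\int[m1]_x \int[m2]_y F (x, y))%E.
  by apply: eq_integral => x _; rewrite innerE.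
rewrite Fubini//; apply: eq_integral => y _.
have iwk : m1.-integrable setT (EFin \o (fun x => w x * k x y)).
  apply: (integrable_mul_bounded w_int (C := 1)) => //.
  have my : measurable_fun setT (fun x : T1 => (x, y)).
    exact: measurable_fun_pair.
  exact: (measurableT_comp mk my).
rewrite EFinM /Rintegral fineK ?integrable_fin_num//.
rewrite -integralZl//; apply: eq_integral => x _.
by rewrite /F/= -EFinM mulrCA.
Qed.

End bounded_kernel.

Section fourier_pairing.
Context {R : realType} {d : nat} (w : d.-tuple R -> R).
Local Notation mu := (lebesgue_tuple R d).
Hypothesis w_int : mu.-integrable setT (EFin \o w).
Hypothesis w_even : forall x, w (scalet (-1) x) = w x.

(** Under x |-> -x the integral turns into its opposite. *)
Lemma Rintegral_even_sin t : \int[mu]_x (w x * sin (2 * pi * dotp t x)) = 0.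
Proof.
have mN : measurable_fun setT (@scalet R d (-1)) by exact: measurable_scalet.
have isin : mu.-integrable setT
    (EFin \o (fun x => w x * sin (2 * pi * dotp t x))).
  apply: (integrable_mul_bounded (C := 1) w_int).
    by apply: measurable_dotp_comp; exact: continuous_sin.
  by move=> x; exact: sin_max.
have NK : involutive (@scalet R d (-1)).
  by move=> x; rewrite scaletA mulrNN mulr1 scale1t.
have Nn x : enorm (@scalet R d (-1) x) = enorm x.
  by rewrite enormZ normrN1 mul1r.
have [_ /=] := @Rintegral_comp_scaled _ _ _ mu 1 (@scalet R d (-1)) _ ltr01 mN
  (fun g mg g0 => etrans (mul1e _) (ge0_integral_isometry mN
     (@scaletDr R d (-1)) NK Nn mg g0)) isin.
rewrite mul1r.
under eq_Rintegral do rewrite w_even dotpZr mulN1r mulrN sinN mulrN.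
rewrite (_ : \int[mu]_x _ = - \int[mu]_x (w x * sin (2 * pi * dotp t x))).
  lra.
rewrite -mulN1r -RintegralZl//.
by apply: eq_Rintegral => x _; rewrite mulN1r.
Qed.

Let measurable_trig_kernel (h : R -> R) : continuous h ->
  measurable_fun setT
    (fun p : d.-tuple R * d.-tuple R => h (2 * pi * dotp p.2 p.1)).
Proof.
move=> hc; have mh : measurable_fun setT h by exact: continuous_measurable_fun.
have ml : measurable_fun setT
    (fun p : d.-tuple R * d.-tuple R => 2 * pi * dotp p.2 p.1).
  by apply: measurable_funM => //; exact: measurable_dotp.
exact: (measurableT_comp mh ml).
Qed.

Let mcos := measurable_trig_kernel (@continuous_cos R).
Let msin := measurable_trig_kernel (@continuous_sin R).

(** Common form of the real part (c = 1, f = Re phi, g = Im phi) and the imaginary part (c = -1,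
    roles exchanged) of the pairing; after Fubini the sine term vanishes because w is even. *)
Let Rintegral_trig_sum (f g : d.-tuple R -> R) (c : R) :
  mu.-integrable setT (EFin \o f) -> mu.-integrable setT (EFin \o g) ->
  \int[mu]_xi (w xi * (\int[mu]_t
    (f t * cos (2 * pi * dotp t xi) + c * (g t * sin (2 * pi * dotp t xi))))) =
  \int[mu]_t (f t * cos_transform w t).
Proof.
move=> intf intg.
have ic xi : mu.-integrable setT
    (EFin \o (fun t => f t * cos (2 * pi * dotp t xi))).
  apply: (integrable_mul_bounded (C := 1) intf); last first.
    by move=> t; exact: cos_max.
  under eq_fun do rewrite dotpC.
  by apply: measurable_dotp_comp; exact: continuous_cos.
have is_ xi : mu.-integrable setT
    (EFin \o (fun t => g t * sin (2 * pi * dotp t xi))).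
  apply: (integrable_mul_bounded (C := 1) intg); last first.
    by move=> t; exact: sin_max.
  under eq_fun do rewrite dotpC.
  by apply: measurable_dotp_comp; exact: continuous_sin.
have Ic := integrable_bounded_kernel (k := fun xi t => cos (2 * pi * dotp t xi))
  w_int intf mcos (fun _ _ => cos_max _).
have Is := integrable_bounded_kernel (k := fun xi t => sin (2 * pi * dotp t xi))
  w_int intg msin (fun _ _ => sin_max _).
transitivity (\int[mu]_xi
  (w xi * (\int[mu]_t (f t * cos (2 * pi * dotp t xi))) +
   c * (w xi * (\int[mu]_t (g t * sin (2 * pi * dotp t xi)))))).
  apply: eq_Rintegral => xi _; rewrite RintegralD//; last first.
    exact: (integrableZl measurableT c (is_ xi)).
  by rewrite RintegralZl// mulrDr mulrCA.
rewrite RintegralD//; last exact: (integrableZl measurableT c Is).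
rewrite RintegralZl//.
rewrite (bounded_kernel_swap (k := fun xi t => cos (2 * pi * dotp t xi))
  w_int intf mcos (fun _ _ => cos_max _)).
rewrite (bounded_kernel_swap (k := fun xi t => sin (2 * pi * dotp t xi))
  w_int intg msin (fun _ _ => sin_max _)).
under [X in _ + _ * X]eq_Rintegral do rewrite Rintegral_even_sin mulr0.
by rewrite [X in _ + _ * X]Rintegral_cst// mul0r mulr0 addr0.
Qed.

Lemma integrable_mul_cos_transform (f : d.-tuple R -> R) :
  mu.-integrable setT (EFin \o f) ->
  mu.-integrable setT (EFin \o (fun t => f t * cos_transform w t)).
Proof.
move=> intf.
apply: (integrable_bounded_kernel (k := fun t xi => cos (2 * pi * dotp t xi))
  intf w_int) => [|t xi]; last exact: cos_max.
have := mcos; rewrite (_ : (fun p => _) =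
  (fun p : d.-tuple R * d.-tuple R => cos (2 * pi * dotp p.1 p.2)))//.
by apply/funext => p; rewrite dotpC.
Qed.

Lemma cintegral_fourier (phi : d.-tuple R -> R[i]) : cintegrable mu phi ->
  cintegral mu (fun xi => (w xi)%:C * fourier phi xi) =
  (\int[mu]_t (complex.Re (phi t) * cos_transform w t)) +i*
  (\int[mu]_t (complex.Im (phi t) * cos_transform w t)).
Proof.
move=> [intRe intIm]; rewrite /cintegral; congr (_ +i* _).
  rewrite -(Rintegral_trig_sum 1 intRe intIm); apply: eq_Rintegral => xi _.
  rewrite /fourier /cintegral /= mul0r subr0; congr (_ * _).
  apply: eq_Rintegral => t _; case: (phi t) => p q /=.
  by rewrite cosN sinN mulrN opprK mul1r.
rewrite -(Rintegral_trig_sum (-1) intIm intRe); apply: eq_Rintegral => xi _.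
rewrite /fourier /cintegral /= mul0r addr0; congr (_ * _).
apply: eq_Rintegral => t _; case: (phi t) => p q /=.
by rewrite cosN sinN mulrN mulN1r addrC.
Qed.

End fourier_pairing.

(** * Dilations, complex modulus and the conclusion *)

Section main_inequality.
Context {R : realType} {d : nat} (W : d.-tuple R -> R).
Local Notation mu := (lebesgue_tuple R d).

(** The normalisation c^-d cancels the Jacobian, so Omega acts only on the argument of M and one
    radius r serves every Omega. *)
Lemma cos_transform_dilation (c : R) : 0 < c ->
  mu.-integrable setT (EFin \o W) ->
  mu.-integrable setT (EFin \o (fun x => c ^- d * W (scalet c^-1 x))) /\
  forall t, cos_transform (fun x => c ^- d * W (scalet c^-1 x)) t =
    cos_transform W (scalet c t).
Proof.
move=> c0 W_int.
have ci0 : 0 < c^-1 by rewrite invr_gt0.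
have mS : measurable_fun setT (@scalet R d c^-1) by exact: measurable_scalet.
have cd0 : 0 < c^-1 ^+ d by rewrite exprn_gt0.
have dil f := @Rintegral_comp_scaled _ _ _ mu (c^-1 ^+ d) (@scalet R d c^-1) f
  cd0 mS (fun g mg g0 => ge0_integral_scalet ci0 mg g0).
split; first by have := integrableZl measurableT (c ^- d) (dil _ W_int).1.
move=> t; have := dil _ (integrable_mul_cos W_int (scalet c t)).
move=> [icos /=]; rewrite /cos_transform => <-; rewrite -RintegralZl//.
apply: eq_Rintegral => x _.
rewrite exprVn dotpZl dotpZr mulrA; congr (_ * cos _).
by rewrite [c * _]mulrA divff ?gt_eqF// mul1r.
Qed.

End main_inequality.

(** W (1 + cos) is nonnegative, so Tonelli gives measurability of its integral in s; M differs from
    it by a constant. *)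
Lemma measurable_cos_transform {R : realType} {d : nat} (W : d.-tuple R -> R) :
  (forall x, 0 <= W x) ->
  (lebesgue_tuple R d).-integrable setT (EFin \o W) ->
  measurable_fun setT (cos_transform W).
Proof.
move=> W0 W_int.
have mW : measurable_fun setT W.
  by apply/measurable_EFinP; exact: measurable_int W_int.
rewrite (_ : cos_transform W = fun s =>
  fine (\int[lebesgue_tuple R d]_x
    (W x * (1 + 1 * cos (2 * pi * dotp s x)))%:E) -
  \int[lebesgue_tuple R d]_x W x); last first.
  apply/funext => s; rewrite [X in X - _](Rintegral_mul_affine_cos W_int).
  by rewrite mul1r addrAC subrr add0r.
apply: measurable_funB => //.
apply: (measurableT_comp (fine_measurable measurableT)).
have mcos : measurable_fun setT (@cos R).
  by apply: continuous_measurable_fun; exact: continuous_cos.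
have ml : measurable_fun setT
    (fun p : d.-tuple R * d.-tuple R => 2 * pi * dotp p.1 p.2).
  by apply: measurable_funM => //; exact: measurable_dotp.
apply: (measurable_fun_fubini_tonelli_F (fun p : d.-tuple R * d.-tuple R =>
  (W p.2 * (1 + 1 * cos (2 * pi * dotp p.1 p.2)))%:E)) => [|p].
  apply/measurable_EFinP; apply: measurable_funM.
    exact: (measurableT_comp mW).
  apply: measurable_funD => //; apply: measurable_funM => //.
  exact: (measurableT_comp mcos ml).
rewrite lee_fin; apply: mulr_ge0 => //.
Qed.

Section complex_modulus.
Context d (T : measurableType d) (R : realType).
Variables (mu : {measure set T -> \bar R}) (phi : T -> R[i]).
Hypothesis phi_int : cintegrable mu phi.

Let mRe : measurable_fun setT (fun t => complex.Re (phi t)).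
Proof.
by case: phi_int => h _; apply/measurable_EFinP; exact: measurable_int h.
Qed.

Let mIm : measurable_fun setT (fun t => complex.Im (phi t)).
Proof.
by case: phi_int => _ h; apply/measurable_EFinP; exact: measurable_int h.
Qed.

Lemma normc_ge0 (z : R[i]) : 0 <= Normc.normc z.
Proof. by case: z => p q; exact: sqrtr_ge0. Qed.

Lemma normc_gt0 (z : R[i]) : (0 < Normc.normc z) = (z != 0).
Proof.
rewrite lt_def normc_ge0 andbT; congr (~~ _); apply/eqP/eqP => [|->].
  exact: Normc.eq0_normc.
exact: Normc.normc0.
Qed.

Lemma measurable_normc : measurable_fun setT (fun t => Normc.normc (phi t)).
Proof.
rewrite (_ : (fun _ => _) = fun t =>
  Num.sqrt (complex.Re (phi t) ^+ 2 + complex.Im (phi t) ^+ 2)); last first.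
  by apply/funext => t; case: (phi t).
have msqrt : measurable_fun setT (@Num.sqrt R).
  by apply: continuous_measurable_fun; exact: sqrt_continuous.
have ms : measurable_fun setT
    (fun t => complex.Re (phi t) ^+ 2 + complex.Im (phi t) ^+ 2).
  by apply: measurable_funD; apply: measurable_funX.
exact: (measurableT_comp msqrt ms).
Qed.

Lemma integrable_normc :
  mu.-integrable setT (EFin \o (fun t => Normc.normc (phi t))).
Proof.
have [iRe iIm] := phi_int.
apply: (le_integrable measurableT _ _
  (integrableD measurableT (integrable_abse iRe) (integrable_abse iIm))).
  by apply/measurable_EFinP; exact: measurable_normc.
move=> t _ /=; rewrite !lee_fin ger0_norm ?normc_ge0//.
case: (phi t) => p q /=; rewrite [leRHS]ger0_norm ?addr_ge0//.
rewrite -(@ler_pXn2r _ 2)// ?nnegrE ?addr_ge0 ?sqrtr_ge0//.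
rewrite sqr_sqrtr ?addr_ge0 ?sqr_ge0// sqrrD !real_normK ?num_real//.
by have := mulr_ge0 (normr_ge0 p) (normr_ge0 q); lra.
Qed.

(** With N = |X + i Y|, N^2 = X X + Y Y is the integral of (X Re phi + Y Im phi) k, and
    Cauchy-Schwarz in the plane bounds the integrand by N |phi| |k|; dividing by N concludes. *)
Lemma normc_Rintegral_le (k : T -> R) :
  mu.-integrable setT (EFin \o (fun t => complex.Re (phi t) * k t)) ->
  mu.-integrable setT (EFin \o (fun t => complex.Im (phi t) * k t)) ->
  mu.-integrable setT (EFin \o (fun t => Normc.normc (phi t) * k t)) ->
  Normc.normc ((\int[mu]_t (complex.Re (phi t) * k t)) +i*
               (\int[mu]_t (complex.Im (phi t) * k t))) <=
  \int[mu]_t (Normc.normc (phi t) * `|k t|).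
Proof.
move=> iRe iIm iN; set X := \int[mu]_t _; set Y := \int[mu]_t _.
rewrite /=; set N := Num.sqrt _.
have N2 : N ^+ 2 = X ^+ 2 + Y ^+ 2 by rewrite sqr_sqrtr// addr_ge0// sqr_ge0.
have [->|N0] := eqVneq N 0.
  by apply: Rintegral_ge0 => t _; rewrite mulr_ge0// normc_ge0.
have N_gt0 : 0 < N by rewrite lt_def N0 sqrtr_ge0.
rewrite -(ler_pM2l N_gt0) -expr2 N2 !expr2 {2}/X {2}/Y.
have iN' : mu.-integrable setT
    (EFin \o (fun t => Normc.normc (phi t) * `|k t|)).
  have := integrable_norm iN.
  apply: eq_integrable => // t _ /=.
  by rewrite normrM (ger0_norm (normc_ge0 _)).
rewrite -!RintegralZl// -RintegralD//; first last.
- by have := integrableZl measurableT Y iIm.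
- by have := integrableZl measurableT X iRe.
apply: le_Rintegral => //.
- exact: (integrableD measurableT (integrableZl measurableT X iRe)
    (integrableZl measurableT Y iIm)).
- exact: (integrableZl measurableT N iN').
move=> t _; case: (phi t) => p q /=.
rewrite !mulrA -mulrDl (le_trans (ler_norm _))// normrM ler_wpM2r//.
rewrite -(@ler_pXn2r _ 2)// ?nnegrE ?mulr_ge0 ?sqrtr_ge0//.
rewrite real_normK ?num_real// exprMn N2 sqr_sqrtr ?addr_ge0 ?sqr_ge0//.
rewrite -subr_ge0 (_ : _ - _ = (X * q - Y * p) ^+ 2) ?sqr_ge0//; ring.
Qed.

End complex_modulus.

Theorem proposition4p1 (R : realType) (d : nat) (alpha : R)
    (hd : (1 <= d)%N) (halpha : - (1 / 2) < alpha) :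
  exists theta : R, 0 < theta /\
    forall (Omega S : R) (phi : d.-tuple R -> R[i]),
      0 < Omega -> 0 < S -> Omega * S `^ (1 / d%:R) <= theta ->
      cintegrable (lebesgue_tuple R d) phi ->
      (lebesgue_tuple R d [set t | phi t != 0%R] <= S%:E)%E ->
      `| cintegral (lebesgue_tuple R d) (fun xi =>
           (Omega ^- d * bochner_riesz alpha (scalet Omega^-1 xi))%:C
             * fourier phi xi) |
      <= cintegral (lebesgue_tuple R d) (fun xi =>
           (Omega ^- d * bochner_riesz alpha (scalet Omega^-1 xi))%:C
             * fourier (fun t => (symm_rearr phi t)%:C) xi).
Proof.
pose W := bochner_riesz alpha : d.-tuple R -> R.
have W_ge0 : forall x, 0 <= W x := bochner_riesz_ge0 alpha.
have W_int := integrable_bochner_riesz hd halpha.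
have W_radial x y : enorm x = enorm y -> W x = W y.
  by rewrite /W /bochner_riesz => ->.
have W_supp x : 1 <= enorm x -> W x = 0.
  by rewrite /W /bochner_riesz ltNge => ->.
have [c c0 W_lb] : exists2 c, 0 < c & forall x, enorm x < 1 / 2 -> c <= W x.
  (* The base lies in [3/4, 1], so the exponent |alpha| gives a lower bound whatever the sign of
     alpha. *)
  exists ((3 / 4) `^ `|alpha|) => [|x x2]; first by rewrite powR_gt0.
  have x0 := enorm_ge0 x.
  rewrite /W /bochner_riesz (_ : enorm x < 1 = true); last by apply/idP; lra.
  have u34 : 3 / 4 <= 1 - enorm x ^+ 2 by nra.
  have u1 : 1 - enorm x ^+ 2 <= 1 by rewrite lerBlDr lerDl sqr_ge0.
  apply: (@le_trans _ _ ((1 - enorm x ^+ 2) `^ `|alpha|)).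
    by apply: ge0_ler_powR; rewrite ?nnegrE//; lra.
  by apply: ger_powR; [rewrite u1 andbT; lra|exact: ler_norm].
have [r r0 peak] :=
  cos_transform_peak hd W_ge0 W_int W_radial W_supp c0 W_lb.
pose V := fine (lebesgue_tuple R d (eball 1)).
have V0 : 0 < V.
  rewrite fine_gt0// eball1_measure_gt0; exact: eball1_measure_lty.
(* A ball of measure S has radius (S / V)^(1/d); this choice makes Omega times that radius at most
   r. *)
exists (r * V `^ (1 / d%:R)); split; first by rewrite mulr_gt0// powR_gt0.
move=> Omega S phi Omega0 S0 hOmega phi_int phi_supp.
have [w_int wE] := cos_transform_dilation Omega0 W_int.
set w := fun x => Omega ^- d * W (scalet Omega^-1 x) in w_int wE.
have w_ge0 x : 0 <= w x by rewrite mulr_ge0// invr_ge0 exprn_ge0// ltW.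
have w_even x : w (scalet (-1) x) = w x.
  by congr (_ * _); apply: W_radial; rewrite !enormZ normrN1 mul1r.
pose a t := Normc.normc (phi t).
have a0 t : 0 <= a t by exact: normc_ge0.
have ma : measurable_fun setT a by exact: measurable_normc phi_int.
have a_int : (lebesgue_tuple R d).-integrable setT (EFin \o a).
  exact: integrable_normc phi_int.
have suppE : [set t | 0 < a t] = [set t | phi t != 0].
  by apply/seteqP; split=> t /=; rewrite normc_gt0.
have supp_lty : (lebesgue_tuple R d [set t | (0 < a t)%R] < +oo)%E.
  by rewrite suppE; exact: le_lt_trans phi_supp (ltry _).
have radius_le : ball_radius [set t | 0 < a t] <= r / Omega.
  have e0 : 0 <= d%:R^-1 :> R by rewrite invr_ge0.
  apply: (@le_trans _ _ ((S / V) `^ d%:R^-1)).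
    apply: ge0_ler_powR;
      rewrite ?nnegrE ?divr_ge0 ?fine_ge0 ?(ltW V0) ?(ltW S0)//.
    rewrite ler_pM2r ?invr_gt0//; rewrite -lee_fin fineK ?ge0_fin_numE//.
    by rewrite suppE.
  rewrite ler_pdivlMr// mulrC -(ler_pM2r (powR_gt0 d%:R^-1 V0)) -mulrA.
  rewrite -powRM ?divr_ge0 ?(ltW V0) ?(ltW S0)// divfK ?gt_eqF//.
  by move: hOmega; rewrite div1r.
pose b := rearrangement a.
have b_int : (lebesgue_tuple R d).-integrable setT (EFin \o b).
  exact: integrable_rearrangement.
have b_cint : cintegrable (lebesgue_tuple R d)
    (fun t => (symm_rearr phi t)%:C).
  split; first exact: b_int.
  exact: integrable0.
rewrite (cintegral_fourier w_int w_even phi_int).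
rewrite (cintegral_fourier w_int w_even b_cint).
pose K := cos_transform w.
have mK : measurable_fun setT K by exact: measurable_cos_transform.
have peakK s t : enorm s <= r / Omega -> enorm s <= enorm t -> `|K t| <= K s.
  move=> sr st; rewrite /K !wE; apply: peak; rewrite !enormZ gtr0_norm//.
    by rewrite -ler_pdivlMl// mulrC.
  by rewrite ler_pM2l.
have bK_int := integrable_mul_cos_transform w_int b_int.
have aK_int := integrable_mul_cos_transform w_int a_int.
(* On the ball carrying b, [peakK] at s = t gives |K| <= K; elsewhere b = 0. *)
have bKE t : b t * `|K t| = b t * K t.
  have [tr|tr] := leP (ball_radius [set t | 0 < a t]) (enorm t).
    by rewrite /b rearrangement_outside ?mul0r.
  have Kt : `|K t| <= K t by apply: peakK => //; rewrite (le_trans (ltW tr)).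
  by rewrite ger0_norm// (le_trans _ Kt).
(* The order of R[i] also demands equal imaginary parts: that of the right side vanishes because the
   rearrangement is real. *)
rewrite lecE /=; apply/andP; split.
  rewrite eq_sym; apply/eqP.
  under eq_Rintegral do rewrite mul0r.
  by rewrite Rintegral_cst// mul0r.
apply: (le_trans (normc_Rintegral_le
  (integrable_mul_cos_transform w_int phi_int.1)
  (integrable_mul_cos_transform w_int phi_int.2) aK_int)).
have absK_int (f : d.-tuple R -> R) : (forall t, 0 <= f t) ->
    (lebesgue_tuple R d).-integrable setT (EFin \o (fun t => f t * K t)) ->
    (lebesgue_tuple R d).-integrable setT (EFin \o (fun t => f t * `|K t|)).
  move=> f0 /integrable_norm; apply: eq_integrable => // t _ /=.
  by rewrite normrM ger0_norm.
have -> : \int[lebesgue_tuple R d]_t (symm_rearr phi t * cos_transform w t) =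
    \int[lebesgue_tuple R d]_t (b t * `|K t|).
  by apply: eq_Rintegral => t _; rewrite bKE.
have b0 t : 0 <= b t by exact: rearrangement_ge0.
apply: fine_le.
- exact: integrable_fin_num (absK_int _ a0 aK_int).
- exact: integrable_fin_num (absK_int _ b0 bK_int).
have := rearrangement_inequality hd ma supp_lty a0 a_int
  (g := fun t => `|K t|) (r := r / Omega).
apply => //; first exact: measurableT_comp.
move=> s t sr st.
by rewrite [leRHS]ger0_norm ?peakK// (le_trans _ (peakK s s _ _)).
Qed.
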